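(* Let $G_{v,r,t}$ be the Gale Robinson quiver, with mutation sequence $1,\dots,v,1,\dots,v,\dots$. Let $s_i$ be the number of partitions of $i$ into parts $r$ and $v-r$ ($0$ for negative $i$ and $1$ for $i=0$). Let $\mathcal W$ be the set of (possibly empty) sequences $\mathbf w=(w_1,\dots,w_k)$ of integers with $1\le w_1\le\cdots\le w_k\le n$. Then $$F_n=\sum_{\mathbf w\in\mathcal W}\phi(\mathbf w)\prod_{i=1}^k\Big(s_{n-w_i}+\sum_{j=i+1}^k\big(-s_{w_j-w_i}-s_{w_j-w_i-v}+s_{w_j-w_i-t}+s_{w_j-w_i-v+t}\big)\Big)\prod_{i=1}^vy_i^{\sum_{j=1}^ks_{w_j-i}}.$$
   Context: The Gale Robinson quiver $G_{v,r,t}$ has vertices $1,\dots,v$ and arrows: $i\to i+r$ for $1\le i\le v-r$ and $j\to v-r+j$ for $1\le j\le r$; $t+i\to i$ for $1\le i\le v-t$ and $v-t+j\to j$ for $1\le j\le t$; $r+i\to t+i$ for $1\le i\le v-r-t$ and $r+j\to v-t+j$ for $1\le j\le t-r$; then all 2-cycles created are deleted. Quiver mutation at $k$: for every path $i\to k\to j$ add an arrow $i\to j$, reverse all arrows incident to $k$, then delete all 2-cycles. The framed quiver has additional frozen vertices $i'$ with one arrow $i'\to i$ for each base vertex $i$; only base vertices are mutated. Initially each base vertex has label $1$ and $i'$ has label $y_i$; mutating at $k$ replaces the label $V_k$ by (product of labels over arrows into $k$ + product of labels over arrows out of $k$, with multiplicity)$/V_k$. The $F$-polynomial $F_n$ is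 the label at the vertex mutated at step $n$, right after step $n$. $\phi(\mathbf w)$ is the number of distinct permutations of $w_1,\dots,w_k$ divided by $k!$ (so $\phi=1$ for the empty sequence, whose products are $1$). The sum is taken coefficientwise as a formal power series in $y_1,\dots,y_v$.
   Formalization: The formal theorem assumes 1 ≤ r < t and r + t < v, the range the arrow description presupposes; outside it the formula can fail (e.g. v = 2, r = t = 1, where all arrows cancel and F_3 = 1). *)

(* Defs.v *)
From mathcomp Require Import all_boot all_order all_algebra.
From mathcomp Require Import fraction.
From mathcomp Require Import mpoly.

Set Implicit Arguments.
Unset Strict Implicit.
Unset Printing Implicit Defensive.

Import GRing.Theory.
Local Open Scope ring_scope.

(* q x y is the number of arrows x -> y. *)
Definition quiver (T : Type) := T -> T -> nat.

(* Truncated subtraction: from each pair of opposite arrows both are removed. *)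
Definition delete_2cycles (T : Type) (q : quiver T) : quiver T :=
  fun x y => (q x y - q y x)%N.

Definition mutate_quiver (T : eqType) (k : T) (q : quiver T) : quiver T :=
  delete_2cycles (fun x y =>
    if (x == k) || (y == k) then q y x else (q x y + q x k * q k y)%N).

(* [inl i] is the base vertex i and [inr i] is the frozen vertex i'. *)
Definition framed (T : eqType) (q : quiver T) : quiver (T + T) :=
  fun x y => match x, y with
             | inl i, inl j => q i j
             | inr i, inl j => (i == j : nat)
             | _, _ => 0%N
             end.

Definition rational_function (v : nat) := {fraction {mpoly rat[v]}}.

Record seed (v : nat) := Seed {
  seed_quiver : quiver ('I_v + 'I_v);
  seed_label : 'I_v + 'I_v -> rational_function v
}.

Definition initial_seed (v : nat) (q : quiver 'I_v) : seed v :=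
  {| seed_quiver := framed q;
     seed_label := fun x => match x with
                            | inl _ => 1
                            | inr i => tofrac ('X_i : {mpoly rat[v]})
                            end |}.

Definition mutate_seed (v : nat) (i : 'I_v) (S : seed v) : seed v :=
  let k : 'I_v + 'I_v := inl i in
  let q := seed_quiver S in
  let L := seed_label S in
  {| seed_quiver := mutate_quiver k q;
     seed_label := fun x =>
       if x == k then
         (\prod_y L y ^+ q y k + \prod_y L y ^+ q k y) / L k
       else L x |}.

(* Step n >= 1 mutates at the base vertex mu n; mu 0 is never used. *)
Fixpoint seed_after (v : nat) (q : quiver 'I_v) (mu : nat -> 'I_v) (n : nat)
    : seed v :=
  if n is n'.+1 then mutate_seed (mu n) (seed_after q mu n')
  else initial_seed q.

Definition F_label (v : nat) (q : quiver 'I_v) (mu : nat -> 'I_v) (n : nat)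
    : rational_function v :=
  seed_label (seed_after q mu n) (inl (mu n)).

(* The vertex numbered a in 1..v is the ordinal of value a - 1. *)
Definition gale_robinson (v r t : nat) : quiver 'I_v :=
  delete_2cycles (fun x y : 'I_v =>
    let arrow (a b : nat) : nat := (x.+1 == a) && (y.+1 == b) in
    (\sum_(1 <= i < (v - r).+1) arrow i (i + r)
     + \sum_(1 <= j < r.+1) arrow j (v - r + j)
     + \sum_(1 <= i < (v - t).+1) arrow (t + i) i
     + \sum_(1 <= j < t.+1) arrow (v - t + j) j
     + \sum_(1 <= i < (v - r - t).+1) arrow (r + i) (t + i)
     + \sum_(1 <= j < (t - r).+1) arrow (r + j) (v - t + j))%N).

(* Steps 1, 2, 3, ... mutate at the vertices numbered 1, ..., v, 1, ..., v, ... *)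
Definition cyclic_sequence (v : nat) (v_gt0 : (0 < v)%N) (n : nat) : 'I_v :=
  Ordinal (ltn_pmod n.-1 v_gt0).

(* Partitions of z into parts a and b, each given by the multiplicities of the
   two parts; this requires a and b to be positive and distinct. *)
Definition npartitions2 (a b : nat) (z : int) : nat :=
  if z is Posz m then
    #|[set p : 'I_m.+1 * 'I_m.+1 | (p.1 * a + p.2 * b == m)%N]|
  else 0%N.

Definition phi (w : seq nat) : rat :=
  (size (permutations w))%:R / ((size w)`!)%:R.

Definition words (n : nat) : pred (seq nat) :=
  fun w => sorted leq w && all (fun x => (0 < x <= n)%N) w.

Definition word_coef (v r t n : nat) (w : seq nat) : rat :=
  let s (z : int) : rat := (npartitions2 r (v - r) z)%:R in
  let W (i : nat) : int := (nth 0%N w i)%:Z in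
  phi w *
  \prod_(0 <= i < size w)
    (s (n%:Z - W i)
     + \sum_(i.+1 <= j < size w)
         (- s (W j - W i) - s (W j - W i - v%:Z)
          + s (W j - W i - t%:Z) + s (W j - W i - v%:Z + t%:Z))).

Definition word_exponent (v r : nat) (w : seq nat) : 'X_{1..v} :=
  [multinom (\sum_(x <- w) npartitions2 r (v - r) (x%:Z - (i.+1)%:Z))%N
     | i < v].

Definition word_term (v r t n : nat) (w : seq nat) : {mpoly rat[v]} :=
  word_coef v r t n w *: 'X_[word_exponent v r w].

(* p is the sum, as a formal power series, of the possibly infinite family of
   the f i with P i: for each monomial m only finitely many members of the
   family involve m, and their coefficients at m add up to that of p. *)
Definition is_coefficientwise_sum (I : eqType) (v : nat) (P : pred I)
    (f : I -> {mpoly rat[v]}) (p : {mpoly rat[v]}) : Prop :=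
  forall m : 'X_{1..v}, exists S : seq I,
    [/\ uniq S, all P S,
        forall i, P i -> (f i)@_m != 0 -> i \in S
      & p@_m = \sum_(i <- S) (f i)@_m].

(* Main.v *)
Require Import Defs.
From mathcomp Require Import all_boot all_order all_algebra.
From mathcomp Require Import fraction.
From mathcomp Require Import mpoly.
From mathcomp Require Import zify ring.
From Stdlib Require Import FunctionalExtensionality.

Set Implicit Arguments.
Unset Strict Implicit.
Unset Printing Implicit Defensive.

Import Order.TTheory GRing.Theory Num.Theory.
Local Open Scope ring_scope.

(** Why the expansion holds.

    Each mutation of the sequence carries the Gale Robinson quiver to itself up
    to a rotation of its vertices, and the frozen vertices only ever have
    arrows into the vertex about to be mutated; their multiplicities are
    partition numbers, since both satisfy the recurrence given by the
    generating function 1 / ((1 - x^r) (1 - x^(v-r))).  Hence, with F_m = 1 for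
    m <= 0 and Y_n the product of the y_i^(s_(n-i)),
      F_n F_(n-v) = Y_n F_(n-t) F_(n-v+t) + F_(n-r) F_(n-v+r)
    ([gr_value_recurrence]).

    On the other side, collect equal letters of a word: if the letter x occurs
    m_x times, [phi] is the product of the 1 / m_x!, and the letters x
    contribute a falling factorial because the interaction b of a letter with
    itself is -1.  So the sum over words is S(a) with a_x = s_(n-x), where
      S(a) = sum over m of prod_x C(a_x + sum_(z > x) m_z b_(x,z), m_x) Y_x^m_x.
    The Vandermonde identity makes S multiplicative, S(a + a') = S(a) S(a')
    ([seriesD]), and S(delta_n) = 1 + Y_n S(b_(.,n)) ([series_unit]).  The
    recurrence of the partition numbers is a linear relation between delta_n and
    the weights a for n, n-v, n-r and n-v+r, and multiplicativity turns it into
    the recurrence of the F_n ([gr_series_recurrence]).  As F_(n-v) has constant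
    term 1, it can be cancelled, so that F_n = S(a).  All identities of power
    series are stated for polynomials, up to monomials of degree at least D
    ([eq_below]), with D arbitrary.

    It remains to see that F_n, a priori a quotient, is a polynomial.  The
    Laurent phenomenon ([laurent_phenomenon]) is proved for all quivers and all
    mutation paths, for labels evaluated at positive rational numbers, where no
    denominator vanishes and where a variable can be specialized freely.  Its
    induction step adjoins a frozen vertex, which makes the label z obtained by
    the first mutation independent of all the older labels; the power of z that
    might remain in a denominator is excluded by a second expansion of the same
    label, from a seed whose labels do not vanish at z = 0 ([laurent_step]).
    Positive rational points are dense ([mpoly_zero_positive]), so this gives a
    Laurent polynomial in the y_i; since F_n F_(n-v) is a polynomial and F_(n-v)
    has constant term 1, its monomial denominator is trivial
    ([monomial_quotient]). *)

(** * Mutation paths *)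

(** The absence of 2-cycles, which includes that of loops. *)
Definition reduced (T : Type) (q : quiver T) :=
  forall x y, q x y = 0%N \/ q y x = 0%N.

Definition opposite (T : Type) (q : quiver T) : quiver T := fun x y => q y x.

Lemma reduced_loopless (T : Type) (q : quiver T) x : reduced q -> q x x = 0%N.
Proof. by move=> qred; case: (qred x x). Qed.

Lemma mutate_quiver_reduced (T : eqType) (q : quiver T) k :
  reduced (mutate_quiver k q).
Proof.
move=> x y; rewrite /mutate_quiver /delete_2cycles; set a := (if _ then _ else _).
set b := (if _ then _ else _); case: (leqP a b) => [|/ltnW]; rewrite -subn_eq0.
  by move/eqP; left.
by move/eqP; right.
Qed.

Lemma mutate_quiver_at (T : eqType) (q : quiver T) k x : reduced q ->
  (mutate_quiver k q k x = q x k) * (mutate_quiver k q x k = q k x).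
Proof.
move=> qred; rewrite /mutate_quiver /delete_2cycles eqxx /= orbT.
by case: (qred k x) => ->; rewrite !(sub0n, subn0).
Qed.

Lemma mutate_quiver_off (T : eqType) (q : quiver T) k x y :
  x != k -> y != k ->
  mutate_quiver k q x y =
    (q x y + q x k * q k y - (q y x + q y k * q k x))%N.
Proof.
by rewrite /mutate_quiver /delete_2cycles => /negPf-> /negPf->.
Qed.

Lemma mutate_quiverK (T : eqType) (q : quiver T) k :
  reduced q -> mutate_quiver k (mutate_quiver k q) = q.
Proof.
move=> qred; have qred' := mutate_quiver_reduced q k.
apply: functional_extensionality => x; apply: functional_extensionality => y.
have [->|nxk] := eqVneq x k.
  by rewrite !mutate_quiver_at.
have [->|nyk] := eqVneq y k.
  by rewrite !mutate_quiver_at.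
rewrite mutate_quiver_off // !(mutate_quiver_at k _ qred).
rewrite !(mutate_quiver_off q nxk) // !(mutate_quiver_off q nyk) //.
rewrite ![(q k _ * q _ k)%N]mulnC.
by case: (qred x y) => ->; lia.
Qed.

Lemma mutate_quiver_opposite (T : eqType) (q : quiver T) k :
  mutate_quiver k (opposite q) = opposite (mutate_quiver k q).
Proof.
apply: functional_extensionality => x; apply: functional_extensionality => y.
rewrite /opposite /mutate_quiver /delete_2cycles [(y == k) || _]orbC.
by case: ifP => // _; rewrite ![(q k _ * q _ k)%N]mulnC.
Qed.

Section Mutation.

Variables (K : fieldType) (T : finType).
Implicit Types (q : quiver T) (x : T -> K) (S : quiver T * (T -> K)).

Definition exchange q x k : K :=
  (\prod_y x y ^+ q y k + \prod_y x y ^+ q k y) / x k.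

Definition relabel x k a : T -> K := fun y => if y == k then a else x y.

Definition mutate S k :=
  (mutate_quiver k S.1, relabel S.2 k (exchange S.1 S.2 k)).

Definition run S (path : seq T) := foldl mutate S path.

Lemma run_cons S k path : run S (k :: path) = run (mutate S k) path.
Proof. by []. Qed.

Lemma relabel_id x k a : relabel x k a k = a.
Proof. by rewrite /relabel eqxx. Qed.

Lemma relabel_neq x k a y : y != k -> relabel x k a y = x y.
Proof. by rewrite /relabel => /negPf->. Qed.

(** Reversing all arrows exchanges the two monomials of every exchange
    relation. *)
Lemma run_opposite q x path : (run (opposite q, x) path).2 = (run (q, x) path).2.
Proof.
elim: path q x => [|k path IH] q x //; rewrite !run_cons /mutate /=.
rewrite mutate_quiver_opposite IH; congr (run (_, relabel _ _ _) _).2.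
by rewrite /exchange /opposite addrC.
Qed.

End Mutation.

Section PositiveLabels.

Variable (T : finType).
Implicit Types (q : quiver T) (x : T -> rat).

Definition positive (I : Type) (x : I -> rat) := forall y, 0 < x y.

Lemma monomial_gt0 x (P : pred T) (e : T -> nat) :
  positive x -> 0 < \prod_(y | P y) x y ^+ e y.
Proof. by move=> x_gt0; apply: prodr_gt0 => y _; apply: exprn_gt0. Qed.

Lemma exchange_gt0 q x k : positive x -> 0 < exchange q x k.
Proof. by move=> x_gt0; rewrite divr_gt0 ?addr_gt0 ?monomial_gt0. Qed.

Lemma relabel_gt0 x k a : positive x -> 0 < a -> positive (relabel x k a).
Proof. by move=> x_gt0 a_gt0 y; rewrite /relabel; case: ifP. Qed.

(** At positive labels, the two monomials of an exchange have a nonzero sum,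
    so that dividing by the new label restores the old one. *)
Lemma mutateK q x k : reduced q -> positive x ->
  mutate (mutate (q, x) k) k = (q, x).
Proof.
move=> qred x_gt0; rewrite /mutate /= mutate_quiverK //; congr pair.
have off (e : T -> nat) : e k = 0%N ->
    \prod_y relabel x k (exchange q x k) y ^+ e y = \prod_y x y ^+ e y.
  move=> ek0; apply: eq_bigr => y _; rewrite /relabel.
  by case: eqP => // ->; rewrite ek0.
apply: functional_extensionality => y; rewrite /relabel.
case: (altP eqP) => // ->; rewrite {1}/exchange eqxx.
under eq_bigr do rewrite mutate_quiver_at //.
under [X in _ + X]eq_bigr do rewrite mutate_quiver_at //.
rewrite !off ?reduced_loopless // addrC /exchange.
have x_neq0 : x k != 0 by rewrite lt0r_neq0.
rewrite invf_div mulrC divfK // lt0r_neq0 //.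
by rewrite addr_gt0 ?monomial_gt0.
Qed.

End PositiveLabels.

(** * Laurent functions of positive rational labels *)

(** Laurent polynomials as functions on positive points, with all coordinates
    invertible: the induction principle follows the way an expansion is
    substituted into another one, and [laurent_eq] makes the class
    independent of values outside of the positive points. *)
Inductive laurent (T : Type) : ((T -> rat) -> rat) -> Prop :=
| laurent_const c : laurent (fun=> c)
| laurent_coord k : laurent (fun x => x k)
| laurent_coordV k : laurent (fun x => (x k)^-1)
| laurent_add g h : laurent g -> laurent h -> laurent (fun x => g x + h x)
| laurent_mul g h : laurent g -> laurent h -> laurent (fun x => g x * h x)
| laurent_eq g h : (forall x, positive x -> g x = h x) -> laurent g -> laurent h.

Lemma laurent_sum (T : Type) (I : Type) (r : seq I) (P : pred I)
    (g : I -> (T -> rat) -> rat) : (forall i, P i -> laurent (g i)) ->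
  laurent (fun x => \sum_(i <- r | P i) g i x).
Proof.
move=> gL; elim: r => [|i r IH].
  by apply: laurent_eq (laurent_const _ 0) => x _; rewrite big_nil.
case Pi: (P i); last first.
  by apply: laurent_eq IH => x _; rewrite big_cons Pi.
apply: laurent_eq (laurent_add (gL i Pi) IH) => x _.
by rewrite big_cons Pi.
Qed.

Lemma laurent_prod (T : Type) (I : Type) (r : seq I) (P : pred I)
    (g : I -> (T -> rat) -> rat) : (forall i, P i -> laurent (g i)) ->
  laurent (fun x => \prod_(i <- r | P i) g i x).
Proof.
move=> gL; elim: r => [|i r IH].
  by apply: laurent_eq (laurent_const _ 1) => x _; rewrite big_nil.
case Pi: (P i); last first.
  by apply: laurent_eq IH => x _; rewrite big_cons Pi.
apply: laurent_eq (laurent_mul (gL i Pi) IH) => x _.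
by rewrite big_cons Pi.
Qed.

Lemma laurent_exp (T : Type) (g : (T -> rat) -> rat) n :
  laurent g -> laurent (fun x => g x ^+ n).
Proof.
move=> gL; apply: (laurent_eq (g := fun x => \prod_(i < n) g x)) => [x _|].
  by rewrite prodr_const card_ord.
by apply: laurent_prod.
Qed.

Lemma laurent_monomial (T : finType) (P : pred T) (e : T -> nat) :
  laurent (fun x => \prod_(y | P y) x y ^+ e y).
Proof. by apply: laurent_prod => y _; apply/laurent_exp/laurent_coord. Qed.

Lemma laurent_monomialV (T : finType) (P : pred T) (e : T -> nat) :
  laurent (fun x => (\prod_(y | P y) x y ^+ e y)^-1).
Proof.
apply: (laurent_eq (g := fun x => \prod_(y | P y) (x y)^-1 ^+ e y)) => [x _|].
  by rewrite -prodfV; apply: eq_bigr => y _; rewrite exprVn.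
by apply: laurent_prod => y _; apply/laurent_exp/laurent_coordV.
Qed.

Lemma laurent_exchange (T : finType) (q : quiver T) k :
  laurent (fun x => exchange q x k).
Proof.
apply: laurent_mul (laurent_coordV k).
by apply: laurent_add; apply: laurent_monomial.
Qed.

Section Substitution.

Variables (E T : Type) (dom : E -> rat -> Prop) (pt : E -> rat -> T -> rat).
Variables (S : (E -> {poly rat}) -> Prop) (W : E -> {poly rat}).
Hypothesis (SC : forall c, S (fun=> c%:P)).
Hypothesis (SD : forall f g, S f -> S g -> S (fun e => f e + g e)).
Hypothesis (SM : forall f g, S f -> S g -> S (fun e => f e * g e)).
Hypothesis (SW : S W).
Hypothesis pt_gt0 : forall e z, dom e z -> positive (pt e z).
Hypothesis pt_coord : forall y, exists2 c, S c &
  forall e z, dom e z -> pt e z y * (W e).[z] = (c e).[z].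
Hypothesis pt_coordV : forall y, exists2 c, S c &
  forall e z, dom e z -> (pt e z y)^-1 * (W e).[z] = (c e).[z].

(** Substitution of rational functions of one variable z into a Laurent
    function, where [E] holds parameters. A common multiple W of all
    denominators clears them, at the cost of a power of W; the class S
    records what is known of the coefficients of the resulting polynomial in
    z. *)
Lemma laurent_substitution (g : (T -> rat) -> rat) : laurent g ->
  exists n, exists2 c, S c &
    forall e z, dom e z -> g (pt e z) * (W e).[z] ^+ n = (c e).[z].
Proof.
have SX f n : S f -> S (fun e => f e ^+ n).
  move=> Sf; elim: n => [|n IH]; first by apply: SC.
  rewrite (_ : (fun e => f e ^+ n.+1) = (fun e => f e * f e ^+ n)).
    exact: SM.
  by apply: functional_extensionality => e; rewrite exprS.
elim=> {g} [c|k|k|g h _ [m [f Sf fE]] _ [n [f' Sf' fE']]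
  |g h _ [m [f Sf fE]] _ [n [f' Sf' fE']]|g h gh _ [m [f Sf fE]]].
- exists 0%N, (fun=> c%:P) => // e z _.
  by rewrite expr0 mulr1 hornerC.
- have [c Sc cE] := pt_coord k.
  by exists 1%N, c => // e z /cE; rewrite expr1.
- have [c Sc cE] := pt_coordV k.
  by exists 1%N, c => // e z /cE; rewrite expr1.
- exists (m + n)%N, (fun e => f e * W e ^+ n + f' e * W e ^+ m).
    by apply: SD; apply: SM => //; apply: SX.
  move=> e z dz; rewrite ?hornerD !hornerM ?horner_exp -fE // -fE' // exprD.
  by move: (_ ^+ m) (_ ^+ n) => a b; ring.
- exists (m + n)%N, (fun e => f e * f' e); first exact: SM.
  move=> e z dz; rewrite ?hornerD !hornerM ?horner_exp -fE // -fE' // exprD.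
  by move: (_ ^+ m) (_ ^+ n) => a b; ring.
- by exists m, f => // e z dz; rewrite -gh ?fE //; apply: pt_gt0.
Qed.

End Substitution.

(** Polynomials in z whose coefficients are Laurent functions; the bound on
    the degree is uniform, so that evaluation at a Laurent function is a
    finite sum. *)
Definition laurent_poly (T : Type) (A : (T -> rat) -> {poly rat}) :=
  (exists d, forall x, (size (A x) <= d)%N) /\
  (forall k, laurent (fun x => (A x)`_k)).

Lemma laurent_polyC (T : Type) (g : (T -> rat) -> rat) :
  laurent g -> laurent_poly (fun x => (g x)%:P).
Proof.
move=> gL; split=> [|k]; first by exists 1%N => x; apply: size_polyC_leq1.
case: k => [|k]; first by apply: laurent_eq gL => x _; rewrite coefC.
by apply: laurent_eq (laurent_const _ 0) => x _; rewrite coefC.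
Qed.

Lemma laurent_polyX (T : Type) : laurent_poly (fun _ : T -> rat => 'X).
Proof.
split=> [|k]; first by exists 2%N => x; rewrite size_polyX.
exact: laurent_const.
Qed.

Lemma laurent_polyD (T : Type) (A B : (T -> rat) -> {poly rat}) :
  laurent_poly A -> laurent_poly B -> laurent_poly (fun x => A x + B x).
Proof.
move=> [[d dA] LA] [[e eB] LB]; split=> [|k].
  exists (maxn d e) => x; apply: leq_trans (size_polyD _ _) _.
  by rewrite geq_max !leq_max dA eB orbT.
apply: laurent_eq (laurent_add (LA k) (LB k)) => x _.
by rewrite coefD.
Qed.

Lemma laurent_polyM (T : Type) (A B : (T -> rat) -> {poly rat}) :
  laurent_poly A -> laurent_poly B -> laurent_poly (fun x => A x * B x).
Proof.
move=> [[d dA] LA] [[e eB] LB]; split=> [|k].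
  exists (d + e)%N => x; apply: leq_trans (size_polyMleq _ _) _.
  by apply: leq_trans (leq_pred _) _; rewrite leq_add.
apply: (laurent_eq (g := fun x => \sum_(j < k.+1) (A x)`_j * (B x)`_(k - j))).
  by move=> x _; rewrite coefM.
by apply: laurent_sum => j _; apply: laurent_mul.
Qed.

Lemma poly_zero_beyond (p : {poly rat}) (z0 : rat) :
  (forall z, z0 < z -> p.[z] = 0) -> p = 0.
Proof.
move=> pz; apply/eqP/negPn/negP => p_neq0.
pose s := [seq z0 + k.+1%:R | k <- iota 0 (size p)].
have s_uniq : uniq s.
  rewrite map_inj_uniq ?iota_uniq // => a b /addrI/eqP.
  by rewrite eqr_nat eqSS => /eqP.
have s_root : all (root p) s.
  apply/allP => z /mapP[k _ ->]; apply/eqP/pz.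
  by rewrite ltrDl ltr0n.
by have := max_poly_roots p_neq0 s_root s_uniq; rewrite size_map size_iota ltnn.
Qed.

(** 'X^n is coprime to W as W does not vanish at 0, so it divides A. *)
Lemma poly_dvdXn (A B W : {poly rat}) n :
  W.[0] != 0 -> A * W = B * 'X^n -> forall k, (k < n)%N -> A`_k = 0.
Proof.
move=> W0 eAW; elim/ltn_ind => k IH lt_kn.
have := congr1 (fun p : {poly rat} => p`_k) eAW.
rewrite coefMXn lt_kn coefM big_ord_recr /= subnn big1 ?add0r; last first.
  by move=> i _; rewrite IH ?mul0r //; apply: ltn_trans lt_kn.
move/eqP; rewrite mulf_eq0 => /orP[/eqP //|].
by rewrite -horner_coef0 (negPf W0).
Qed.

(** * Three successive mutations at two vertices *)

Section ThreeMutations.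

Variables (T : finType) (q : quiver T) (i j : T) (x : T -> rat).
Hypotheses (q_reduced : reduced q) (neq_ji : j != i) (qij0 : q i j = 0%N).
Hypothesis x_gt0 : positive x.

(** Monomials in the labels away from the two vertices that are mutated. *)
Definition away_monomial (y : T -> rat) (e : T -> nat) : rat :=
  \prod_(o | (o != i) && (o != j)) y o ^+ e o.

Lemma prod_split_pair (f : T -> rat) :
  \prod_o f o = f i * (f j * \prod_(o | (o != i) && (o != j)) f o).
Proof. by rewrite (bigD1 i) //= (bigD1 j). Qed.

Lemma eq_away_monomial (y y' : T -> rat) (e e' : T -> nat) :
  (forall o, o != i -> o != j -> y o ^+ e o = y' o ^+ e' o) ->
  away_monomial y e = away_monomial y' e'.
Proof. by move=> yy'; apply: eq_bigr => o /andP[oi oj]; apply: yy'. Qed.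

Lemma away_monomial_gt0 e : 0 < away_monomial x e.
Proof. exact: monomial_gt0. Qed.

Let b := q j i.
Let q1 := mutate_quiver i q.
Let z := exchange q x i.
Let x1 := relabel x i z.
Let q2 := mutate_quiver j q1.
Let u := exchange q1 x1 j.
Let x2 := relabel x1 j u.
Let v := exchange q2 x2 i.

Let r := away_monomial x (q1^~ j).
Let s := away_monomial x (q1 j).
Let P := away_monomial x (q^~ i).
Let Q := away_monomial x (q i).
Let g := away_monomial x (fun o => minn (q i o) (q o i + b * q1 j o)).

Let neq_ij : i != j. Proof. by rewrite eq_sym. Qed.
Let q1_reduced : reduced q1. Proof. exact: mutate_quiver_reduced. Qed.
Let q1_out o : q1 i o = q o i. Proof. by rewrite /q1 mutate_quiver_at. Qed.
Let q1_in o : q1 o i = q i o. Proof. by rewrite /q1 mutate_quiver_at. Qed.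

Lemma first_exchange : z * x i = x j ^+ b * P + Q.
Proof.
rewrite /z /exchange divfK ?lt0r_neq0 // !prod_split_pair.
by rewrite reduced_loopless // qij0 !expr0 !mul1r.
Qed.

Let z_gt0 : 0 < z. Proof. exact: exchange_gt0. Qed.
Let x1_gt0 : positive x1. Proof. exact: relabel_gt0. Qed.
Let u_gt0 : 0 < u. Proof. exact: exchange_gt0. Qed.

Lemma second_exchange : u * x j = z ^+ b * r + s.
Proof.
have x1j : x1 j = x j by rewrite /x1 relabel_neq.
rewrite /u /exchange x1j divfK ?lt0r_neq0 // !prod_split_pair.
rewrite reduced_loopless // !expr0 !mul1r {1 2}/x1 relabel_id.
rewrite q1_out q1_in qij0 expr0 mul1r.
by congr (_ ^+ _ * _ + _); apply: eq_away_monomial => o oi oj;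
  rewrite /x1 relabel_neq.
Qed.

(** The arrows between i and the other vertices are changed by the arrows of
    j, up to a monomial g that is lost when 2-cycles are deleted.
    Substituting the first two exchange relations leaves a right-hand side
    divisible by z: u ^+ b agrees with (s / x j) ^+ b modulo z, and the
    corresponding part of the sum is s ^+ b times the numerator z * x i of
    the first relation. *)
Lemma third_exchange :
  v * z * g * x j ^+ b =
    s ^+ b * x i * z + Q * ((z ^+ b * r + s) ^+ b - s ^+ b).
Proof.
have x2i : x2 i = z by rewrite /x2 relabel_neq // /x1 relabel_id.
have x2j : x2 j = u by rewrite /x2 relabel_id.
have q2ji : q2 j i = b by rewrite /q2 mutate_quiver_at ?q1_out.
have q2ij : q2 i j = 0%N by rewrite /q2 mutate_quiver_at ?q1_in.
have x2o o : o != i -> o != j -> x2 o = x o.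
  by move=> oi oj; rewrite /x2 relabel_neq // /x1 relabel_neq.
have q2io o : o != i -> o != j ->
    q2 i o = (q o i + b * q1 j o - q i o)%N /\
    q2 o i = (q i o - (q o i + b * q1 j o))%N.
  move=> oi oj; rewrite /q2 !mutate_quiver_off //.
  by rewrite !q1_in !q1_out qij0 muln0 addn0.
have -> : v * z = u ^+ b * away_monomial x (q2^~ i) + away_monomial x (q2 i).
  rewrite /v /exchange x2i divfK ?lt0r_neq0 // !prod_split_pair.
  rewrite reduced_loopless ?q2ij ?q2ji ?x2j ?expr0 ?mul1r; last first.
    exact: mutate_quiver_reduced.
  by congr (_ * _ + _); apply: eq_away_monomial => o oi oj; rewrite x2o.
have gin : away_monomial x (q2^~ i) * g = Q.
  rewrite -big_split; apply: eq_bigr => o /andP[oi oj] /=.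
  by rewrite -exprD (proj2 (q2io o oi oj)); congr (_ ^+ _); lia.
have gout : away_monomial x (q2 i) * g = P * s ^+ b.
  rewrite -prodrXl -!big_split; apply: eq_bigr => o /andP[oi oj] /=.
  by rewrite -exprM -!exprD (proj1 (q2io o oi oj)); congr (_ ^+ _); lia.
rewrite mulrDl -mulrA gin gout mulrDl.
rewrite [u ^+ b * Q * _]mulrAC -exprMn second_exchange.
have := first_exchange; move: (x j ^+ b) (z ^+ b * r + s) => xb y zx.
rewrite -[s ^+ b * x i * z]mulrA [x i * z]mulrC zx; ring.
Qed.

End ThreeMutations.

(** A new frozen vertex [None] with one arrow to i. *)
Definition adjoin (T : eqType) (q : quiver T) (i : T) : quiver (option T) :=
  fun o o' => match o, o' with
              | Some y, Some y' => q y y'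
              | None, Some y => (y == i : nat)
              | _, None => 0%N
              end.

Definition adjoin_label (T : Type) (x : T -> rat) (f : rat) : option T -> rat :=
  fun o => if o is Some y then x y else f.

Lemma adjoin_reduced (T : eqType) (q : quiver T) i :
  reduced q -> reduced (adjoin q i).
Proof.
by move=> qred [y|] [y'|] /=; [apply: qred | left | right | left].
Qed.

Lemma prod_option (T : finType) (f : option T -> rat) :
  \prod_o f o = f None * \prod_y f (Some y).
Proof.
rewrite (bigD1 None) //=; congr (_ * _).
rewrite (reindex_omap (Some : T -> option T) id); last by case.
by apply: eq_bigl => y; rewrite /= eqxx.
Qed.

(** A frozen vertex with label 1 contributes a factor 1 to every exchange, so
    it can be forgotten. *)
Lemma run_restrict (T : finType) (Q : quiver (option T)) (X : option T -> rat)
    (path : seq T) c : X None = 1 ->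
  (run (Q, X) (map Some path)).2 (Some c) =
  (run (fun y y' => Q (Some y) (Some y'), X \o Some) path).2 c.
Proof.
elim: path Q X => [|k path IH] Q X XN //=.
rewrite /mutate /= IH /=; last by rewrite relabel_neq.
congr ((run (_, _) _).2 c).
apply: functional_extensionality => y; rewrite /relabel /=.
rewrite (_ : (Some y == Some k) = (y == k)) //; case: ifP => // _.
by rewrite /exchange !prod_option XN !expr1n !mul1r.
Qed.

(** * A frozen vertex that frees the first new label *)

(** After the frozen vertex has been adjoined, the labels u and v created by
    the mutations at j and again at i depend on f only through z, and
    polynomially. They do not vanish at z = 0: their values there are ratios
    of sums of monomials in positive labels. The hypothesis q i j = 0 says
    that j and the frozen vertex lie on the same side of i, so that no arrow
    between them is created. *)
Lemma three_mutations_poly (T : finType) (q : quiver T) (i j : T)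
    (xi : T -> rat) : reduced q -> j != i -> q i j = 0%N -> positive xi ->
  exists U V : {poly rat}, [/\ U.[0] != 0, V.[0] != 0 &
    forall f, 0 < f ->
      let S1 := mutate (adjoin q i, adjoin_label xi f) (Some i) in
      let S2 := mutate S1 (Some j) in
      let S3 := mutate S2 (Some i) in
      let z := S1.2 (Some i) in
      S2.2 (Some j) = U.[z] /\ S3.2 (Some i) = V.[z]].
Proof.
move=> qred ji qij0 xi_gt0.
pose aq := adjoin q i; pose q1 := mutate_quiver (Some i) aq.
have label_gt0 f : 0 < f -> positive (adjoin_label xi f).
  by move=> f_gt0 [y|] //=.
pose M e := away_monomial (Some i) (Some j) (adjoin_label xi 1) e.
have ME f e : e None = 0%N ->
    away_monomial (Some i) (Some j) (adjoin_label xi f) e = M e.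
  by move=> e0; apply: eq_away_monomial => -[y|] //; rewrite e0.
have M_gt0 e : 0 < M e by apply: away_monomial_gt0; apply: label_gt0.
pose b := q j i.
pose r := M (q1^~ (Some j)); pose s := M (q1 (Some j)); pose Q := M (aq (Some i)).
pose ge o := minn (aq (Some i) o) (aq o (Some i) + b * q1 (Some j) o).
(* C + s is the numerator of u. The quotient of (C + s) ^+ b - s ^+ b by 'X is
   H; for b = 0 the difference is 0, as is the empty sum. *)
pose C : {poly rat} := r *: 'X^b.
pose H : {poly rat} :=
  r *: 'X^(b.-1) * \sum_(k < b) (C + s%:P) ^+ (b.-1 - k) * s%:P ^+ k.
pose U := (xi j)^-1 *: (C + s%:P).
pose V := (xi j ^+ b * M ge)^-1 *: ((s ^+ b * xi i)%:P + Q *: H).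
have [r_gt0 s_gt0 Q_gt0] : [/\ 0 < r, 0 < s & 0 < Q] by split; apply: M_gt0.
have C0 : 0 <= C.[0] by rewrite hornerZ hornerXn mulr_ge0 ?exprn_ge0 // ltW.
have H0 : 0 <= H.[0].
  rewrite hornerM hornerZ hornerXn horner_sum.
  apply: mulr_ge0; first by rewrite mulr_ge0 ?exprn_ge0 // ltW.
  apply: sumr_ge0 => k _; rewrite hornerM !horner_exp hornerD hornerC.
  by rewrite mulr_ge0 ?exprn_ge0 ?addr_ge0 // ltW.
exists U, V; split=> [||f f_gt0].
- rewrite hornerZ hornerD hornerC lt0r_neq0 // mulr_gt0 ?invr_gt0 //.
  exact: ltr_wpDl.
- rewrite !(hornerZ, hornerD, hornerC) lt0r_neq0 // mulr_gt0 //.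
    by rewrite invr_gt0 mulr_gt0 ?exprn_gt0.
  apply: ltr_wpDr; first by rewrite mulr_ge0 // ltW.
  by rewrite mulr_gt0 ?exprn_gt0.
set X := adjoin_label xi f; have X_gt0 : positive X by apply: label_gt0.
have aq_red : reduced aq by apply: adjoin_reduced.
have aji : Some j != Some i :> option T by [].
have q1N : q1 None (Some j) = 0%N /\ q1 (Some j) None = 0%N.
  by rewrite /q1 !mutate_quiver_off //= (negPf ji) qij0; split; lia.
pose z := exchange aq X (Some i); pose x1 := relabel X (Some i) z.
pose u := exchange q1 x1 (Some j).
pose v := exchange (mutate_quiver (Some j) q1) (relabel x1 (Some j) u) (Some i).
move=> S1 S2 S3 z'; have -> : z' = z by rewrite /z' /S1 /= relabel_id.
have -> : S2.2 (Some j) = u by rewrite /S2 /= relabel_id.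
have -> : S3.2 (Some i) = v by rewrite /S3 /= relabel_id.
have z_gt0 : 0 < z by apply: exchange_gt0.
have [xj_gt0 xi_gt0'] : 0 < xi j /\ 0 < xi i by split.
have hC : C.[z] + s = z ^+ b * r + s by rewrite hornerZ hornerXn mulrC.
have uE : u * xi j = z ^+ b * r + s.
  have := second_exchange aq_red aji qij0 X_gt0.
  by rewrite -/q1 -/z -/x1 -/u !ME //= ?q1N.1 ?q1N.2.
have vE : v * z * M ge * xi j ^+ b
      = s ^+ b * xi i * z + Q * ((z ^+ b * r + s) ^+ b - s ^+ b).
  have := third_exchange aq_red aji qij0 X_gt0.
  rewrite -/q1 -/z -/x1 -/u -/v (ME f ge) //; last exact: min0n.
  rewrite (ME f (q1 (Some j))); last exact: q1N.2.
  rewrite (ME f (q1^~ (Some j))); last exact: q1N.1.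
  by rewrite (ME f (aq (Some i))).
split.
  by rewrite hornerZ hornerD hornerC hC -uE mulrC mulfK ?lt0r_neq0.
have HE : z * H.[z] = (z ^+ b * r + s) ^+ b - s ^+ b.
  rewrite subrXX hornerM hornerZ hornerXn horner_sum.
  have [b0|b_gt0] := posnP b; first by rewrite b0 !big_ord0 !mulr0.
  have -> : z ^+ b * r + s - s = z * (r * z ^+ b.-1).
    by rewrite addrK -{1}(prednK b_gt0) exprS; ring.
  rewrite -!mulrA; do 3 congr (_ * _); congr (_ * _); apply: eq_bigr => k _.
  by rewrite hornerM !horner_exp hornerD !hornerC hC.
rewrite !(hornerZ, hornerD, hornerC).
apply: (mulIf (lt0r_neq0 z_gt0)).
have am : xi j ^+ b * M ge != 0 by rewrite lt0r_neq0 // mulr_gt0 ?exprn_gt0.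
move: HE vE am; move: (xi j ^+ b) (M ge) H.[z] => a m h HE vE am.
transitivity ((a * m)^-1 * (s ^+ b * xi i * z + Q * (z * h))); last by ring.
apply: (mulfI am); rewrite [RHS]mulrA divff // mul1r HE -vE; ring.
Qed.

Section FreeVariable.

Variables (T : finType) (q : quiver T) (i : T).

Let P0 (xi : T -> rat) := \prod_y xi y ^+ q y i.
Let Q0 (xi : T -> rat) := \prod_y xi y ^+ q i y.

(** The label of the frozen vertex for which the first mutation creates the
    label 'X at i. *)
Definition free_label (xi : T -> rat) : {poly rat} :=
  (xi i / P0 xi)%:P * 'X + (- (Q0 xi / P0 xi))%:P.

Lemma laurent_poly_free_label : laurent_poly free_label.
Proof.
have PV := laurent_monomialV predT (q^~ i).
apply: laurent_polyD.
  apply: laurent_polyM (@laurent_polyX T).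
  by apply: laurent_polyC; apply: laurent_mul => //; apply: laurent_coord.
apply: laurent_polyC.
have QL := laurent_monomial predT (q i).
apply: laurent_eq (laurent_mul (laurent_const _ (-1)) (laurent_mul QL PV)).
by move=> x _; rewrite mulN1r.
Qed.

Lemma free_labelE xi z : (free_label xi).[z] = (z * xi i - Q0 xi) / P0 xi.
Proof. by rewrite hornerD hornerM !hornerC hornerX; ring. Qed.

Lemma exchange_free_label xi z : positive xi ->
  exchange (adjoin q i) (adjoin_label xi (free_label xi).[z]) (Some i) = z.
Proof.
move=> xi_gt0; rewrite /exchange !prod_option /= eqxx expr1 expr0 mul1r.
rewrite -/(P0 xi) -/(Q0 xi) free_labelE.
have P_neq0 : P0 xi != 0 by rewrite lt0r_neq0 ?monomial_gt0.
have x_neq0 : xi i != 0 by rewrite lt0r_neq0.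
by field; apply/andP.
Qed.

Lemma free_label_gt0 xi z : positive xi -> Q0 xi / xi i < z ->
  0 < (free_label xi).[z].
Proof.
move=> xi_gt0; rewrite ltr_pdivrMr // => lt_Qz.
by rewrite free_labelE divr_gt0 ?subr_gt0 ?monomial_gt0.
Qed.

Lemma free_label_at0 xi : positive xi -> (free_label xi).[0] != 0.
Proof.
move=> xi_gt0; rewrite free_labelE mul0r add0r mulNr oppr_eq0.
by rewrite lt0r_neq0 // divr_gt0 ?monomial_gt0.
Qed.

Lemma free_label_exchange xi : positive xi ->
  (free_label xi).[exchange q xi i] = 1.
Proof.
move=> xi_gt0; rewrite free_labelE divfK ?lt0r_neq0 // addrK divff //.
by rewrite lt0r_neq0 ?monomial_gt0.
Qed.

End FreeVariable.

(** * The Laurent phenomenon *)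

(** Let l be the label in question, xi the old labels, z the label created at
    i and f the label of the adjoined frozen vertex. Expanding l from the
    seed mutated at i gives l (z f)^n = A(z), where the coefficients of A are
    Laurent functions of xi. Expanding it from the seed mutated at i, j and i
    gives l (u v f)^m = B(z), where u, v and f do not vanish at z = 0. For
    fixed xi this holds for infinitely many z, so z^n divides A; dividing and
    setting f = 1 expresses l as a polynomial in z = exchange q xi i, which
    is itself a Laurent function. *)
Lemma laurent_step (T : finType) (q : quiver T) (i j c : T) (path : seq T)
    (G1 G3 : (option T -> rat) -> rat) :
  reduced q -> j != i -> q i j = 0%N -> laurent G1 -> laurent G3 ->
  (forall xi f, positive xi -> 0 < f ->
    let S1 := mutate (adjoin q i, adjoin_label xi f) (Some i) in
    let S3 := mutate (mutate S1 (Some j)) (Some i) in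
    let l := (run S1 (map Some (j :: path))).2 (Some c) in
    l = G1 S1.2 /\ l = G3 S3.2) ->
  laurent (fun xi => (run (q, xi) (i :: j :: path)).2 c).
Proof.
move=> qred ji qij0 G1L G3L GE.
pose phi := free_label q i; have phiL := laurent_poly_free_label q i.
pose dom (xi : T -> rat) z := [/\ positive xi, 0 < z & 0 < (phi xi).[z]].
pose X0 xi z := adjoin_label xi (phi xi).[z].
pose pt xi z := relabel (X0 xi z) (Some i) z.
pose aq := adjoin q i.
have X0_gt0 xi z : dom xi z -> positive (X0 xi z).
  by case=> xi_gt0 _ f_gt0 [y|] /=.
have X0E xi z : dom xi z -> exchange aq (X0 xi z) (Some i) = z.
  by case=> xi_gt0 _ _; apply: exchange_free_label.
have pt_gt0 xi z : dom xi z -> positive (pt xi z).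
  by move=> dz; apply: relabel_gt0; [apply: X0_gt0 | case: dz].
have LX : laurent_poly (fun _ : T -> rat => 'X) by apply: laurent_polyX.
have LW : laurent_poly (fun xi => 'X * phi xi) by apply: laurent_polyM.
have LC c' : laurent_poly (fun _ : T -> rat => c'%:P).
  by apply: laurent_polyC; apply: laurent_const.
have dom_neq0 xi z : dom xi z -> z != 0 /\ (phi xi).[z] != 0.
  by case=> _ z_gt0 f_gt0; rewrite !lt0r_neq0.
(* The only denominators after the mutation at i are z itself and f = phi. *)
have [n [A [[d sizeA] coefA] AE]] : exists n, exists2 A, laurent_poly A &
    forall xi z, dom xi z -> G1 (pt xi z) * ('X * phi xi).[z] ^+ n = (A xi).[z].
  apply: (laurent_substitution (S := @laurent_poly T)) => //.
  - exact: laurent_polyD.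
  - exact: laurent_polyM.
  - case=> [y|].
      have [->|yi] := eqVneq y i.
        exists (fun xi => 'X * ('X * phi xi)); first exact: laurent_polyM.
        by move=> xi z _; rewrite /pt relabel_id [RHS]hornerM hornerX.
      exists (fun xi => (xi y)%:P * ('X * phi xi)).
        by apply: laurent_polyM => //; apply/laurent_polyC/laurent_coord.
      by move=> xi z _; rewrite /pt relabel_neq // [RHS]hornerM hornerC.
    exists (fun xi => phi xi * ('X * phi xi)); first exact: laurent_polyM.
    by move=> xi z _; rewrite /pt relabel_neq // [RHS]hornerM.
  - case=> [y|].
      have [->|yi] := eqVneq y i.
        exists phi => // xi z /dom_neq0[z_neq0 _].
        by rewrite /pt relabel_id hornerM hornerX mulKf.
      exists (fun xi => (xi y)^-1%:P * ('X * phi xi)).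
        by apply: laurent_polyM => //; apply/laurent_polyC/laurent_coordV.
      by move=> xi z _; rewrite /pt relabel_neq // [RHS]hornerM hornerC.
    exists (fun=> 'X) => // xi z /dom_neq0[_ f_neq0].
    by rewrite /pt relabel_neq // hornerM mulrC mulfK.
pose l xi f := (run (aq, adjoin_label xi f) (map Some [:: i, j & path])).2 (Some c).
have lE1 xi z : dom xi z -> l xi (phi xi).[z] = G1 (pt xi z).
  move=> dz; have [xi_gt0 _ f_gt0] := dz.
  by have [] := GE xi _ xi_gt0 f_gt0; rewrite /l /= {1}X0E.
have A_dvd xi k : positive xi -> (k < n)%N -> (A xi)`_k = 0.
  move=> xi_gt0.
  have [U [V [U0 V0 UV]]] := three_mutations_poly qred ji qij0 xi_gt0.
  pose S1 z := mutate (aq, X0 xi z) (Some i).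
  pose S2 z := mutate (S1 z) (Some j); pose S3 z := mutate (S2 z) (Some i).
  have S1i z : dom xi z -> (S1 z).2 (Some i) = z.
    by move=> dz; rewrite /S1 /= relabel_id X0E.
  have UVE z : dom xi z ->
      (S2 z).2 (Some j) = U.[z] /\ (S3 z).2 (Some i) = V.[z].
    move=> dz; have [_ _ f_gt0] := dz; have := UV _ f_gt0.
    by cbv zeta; rewrite -/aq -/(X0 xi z) -/(S1 z) -/(S2 z) -/(S3 z) S1i.
  have S_gt0 z : dom xi z -> [/\ positive (S1 z).2, positive (S2 z).2 & positive (S3 z).2].
    move=> dz; have S1_gt0 : positive (S1 z).2.
      by apply: relabel_gt0; [|apply: exchange_gt0]; apply: X0_gt0.
    have S2_gt0 : positive (S2 z).2.
      by apply: relabel_gt0; [|apply: exchange_gt0].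
    by split=> //; apply: relabel_gt0; [|apply: exchange_gt0].
  have S3y z y : dom xi z -> (S3 z).2 (Some y) =
      if y == i then V.[z] else if y == j then U.[z] else xi y.
    move=> dz; case: eqP => [->|/eqP yi]; first by case: (UVE z dz).
    rewrite {1}/S3 /= relabel_neq //; case: eqP => [->|/eqP yj].
      by case: (UVE z dz).
    by rewrite relabel_neq // relabel_neq.
  have S3N z : (S3 z).2 None = (phi xi).[z] by [].
  pose W3 := U * V * phi xi.
  have W30 : W3.[0] != 0.
    by rewrite !hornerM !mulf_neq0 // free_label_at0.
  have [m [B _ BE]] : exists m, exists2 B : unit -> {poly rat}, True &
      forall e z, dom xi z -> G3 (S3 z).2 * W3.[z] ^+ m = (B e).[z].
    apply: (laurent_substitution (E := unit) (dom := fun=> dom xi)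
      (pt := fun _ z => (S3 z).2) (S := fun=> True) (W := fun=> W3)) => //.
    - by move=> _ z dz; case: (S_gt0 z dz).
    - case=> [y|]; last first.
        exists (fun=> phi xi * W3) => // _ z dz.
        by rewrite [RHS]hornerM S3N.
      exists (fun=> (if y == i then V else if y == j then U else (xi y)%:P) * W3).
        by [].
      move=> _ z dz; rewrite [RHS]hornerM S3y //.
      by case: ifP => // _; case: ifP => // _; rewrite hornerC.
    - case=> [y|]; last first.
        exists (fun=> U * V) => // _ z /dom_neq0[_ f_neq0].
        by rewrite /W3 [_.[z]]hornerM mulrC S3N mulfK.
      exists (fun=> if y == i then U * phi xi else if y == j then V * phi xi
                    else (xi y)^-1%:P * W3) => // _ z dz.
      have [_ U_gt0 V_gt0] := S_gt0 z dz; have [UE VE] := UVE z dz.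
      rewrite S3y //; case: ifP => _.
        by rewrite !hornerM -VE mulrA [U.[z] * _]mulrC mulKf // lt0r_neq0.
      case: ifP => _; last by rewrite [RHS]hornerM hornerC.
      by rewrite /W3 !hornerM -UE -mulrA mulKf // lt0r_neq0.
  (* Both sides are l times the same powers of W3 and of z * f wherever the
     labels are positive, which is an unbounded interval of z. *)
  have polyE : A xi * W3 ^+ m = B tt * ('X * phi xi) ^+ n.
    apply/eqP; rewrite -subr_eq0; apply/eqP.
    pose z0 := (\prod_y xi y ^+ q i y) / xi i.
    apply: (@poly_zero_beyond _ z0) => z lt_z0z.
    have z_gt0 : 0 < z.
      apply: lt_trans lt_z0z; rewrite divr_gt0 //; exact: monomial_gt0.
    have dz : dom xi z by split=> //; apply: free_label_gt0.
    rewrite hornerD hornerN !hornerM !horner_exp -AE // -(BE tt) //.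
    have [_ _ f_gt0] := dz; have [e1 e3] := GE xi _ xi_gt0 f_gt0.
    have -> : G1 (pt xi z) = G3 (S3 z).2.
      by rewrite -lE1 // /l /= e3.
    by rewrite mulrAC subrr.
  have W3m0 : (W3 ^+ m).[0] != 0 by rewrite horner_exp expf_neq0.
  by apply: (poly_dvdXn W3m0 (B := phi xi ^+ n * B tt)); rewrite polyE exprMn; ring.
apply: (laurent_eq (g := fun xi =>
  \sum_(k < d) (A xi)`_(k + n) * exchange q xi i ^+ k)); last first.
  apply: laurent_sum => k _; apply: laurent_mul => //.
  exact/laurent_exp/laurent_exchange.
move=> xi xi_gt0; pose z := exchange q xi i.
have z_gt0 : 0 < z by apply: exchange_gt0.
have phi1 : (phi xi).[z] = 1 by apply: free_label_exchange.
have dz : dom xi z by split=> //; rewrite phi1.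
have -> : (run (q, xi) [:: i, j & path]).2 c = G1 (pt xi z).
  rewrite -lE1 // phi1 /l run_restrict //.
have := AE xi z dz; rewrite hornerM hornerX phi1 mulr1 => eA.
have zn_neq0 : z ^+ n != 0 by rewrite expf_neq0 ?lt0r_neq0.
apply: (mulIf zn_neq0); rewrite eA (@horner_coef_wide _ (n + d)); last first.
  exact: leq_trans (sizeA xi) (leq_addl _ _).
rewrite big_split_ord /= [X in X + _]big1 ?add0r; last first.
  by move=> k _; rewrite (A_dvd xi k xi_gt0 (ltn_ord k)) mul0r.
rewrite mulr_suml; apply: eq_bigr => k _.
by rewrite -mulrA -exprD [(k + n)%N]addnC.
Qed.

(** Induction on the length of the path, for all quivers at once. The two
    expansions needed by [laurent_step] come from shorter paths: drop the
    first mutation i, or start after the mutations i, j, i, which the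
    mutation at i undoes before the path continues. *)
Theorem laurent_phenomenon (T : finType) (q : quiver T) (path : seq T) (c : T) :
  reduced q -> laurent (fun x => (run (q, x) path).2 c).
Proof.
move: {2}(size path) (leqnn (size path)) => n.
elim: n T q path c => [|n IH] T q [|i [|j path]] c //= le_pn qred;
  try exact: laurent_coord.
  have [->|ci] := eqVneq c i.
    apply: laurent_eq (laurent_exchange q i) => x _.
    by rewrite relabel_id.
  by apply: laurent_eq (laurent_coord c) => x _; rewrite relabel_neq.
have [eji|ji] := eqVneq j i.
  subst j; apply: laurent_eq (IH T q path c (ltnW le_pn) qred) => x x_gt0.
  by rewrite /= (mutateK i qred x_gt0).
have step q' : reduced q' -> q' i j = 0%N ->
    laurent (fun x => (run (q', x) [:: i, j & path]).2 c).
  move=> qred' qij0.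
  pose q1 := mutate_quiver (Some i) (adjoin q' i).
  pose q3 := mutate_quiver (Some i) (mutate_quiver (Some j) q1).
  have IH' := IH (option T) _ (map Some _) (Some c).
  have L1 := IH' q1 (j :: path); have L3 := IH' q3 (i :: path).
  rewrite /= size_map in L1 L3.
  apply: (laurent_step qred' ji qij0 (L1 _ _) (L3 _ _)) => //;
    try exact: mutate_quiver_reduced.
  move=> xi f xi_gt0 f_gt0 S1 S3 l; split; first by [].
  rewrite /l /= /S3 mutateK //; first exact: mutate_quiver_reduced.
  have X_gt0 : positive (adjoin_label xi f) by case.
  have S1_gt0 : positive S1.2 by apply: relabel_gt0; last exact: exchange_gt0.
  by apply: relabel_gt0; last exact: exchange_gt0.
have [qij0|qji0] := qred i j; first exact: step.
have op_red : reduced (opposite q).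
  by move=> x y; case: (qred y x); [left|right].
apply: laurent_eq (step (opposite q) op_red qji0) => x _.
by rewrite run_opposite.
Qed.

(** * Partitions into two parts *)

(** Any large enough bound on the multiplicities of the parts gives the same
    count, and for negative z it counts nothing; a common bound is what makes
    counts for different z comparable. *)
Lemma npartitions2E (a b K : nat) (z : int) :
  (0 < a)%N -> (0 < b)%N -> z < K%:Z ->
  npartitions2 a b z =
    (\sum_(i < K) \sum_(j < K) ((i * a + j * b)%:Z == z))%N.
Proof.
move=> a_gt0 b_gt0; case: z => [m|m] ltmK; last first.
  by rewrite big1 // => i _; rewrite big1.
have ltm1K : (m.+1 <= K)%N by [].
pose F i j : nat := (i * a + j * b)%:Z == m.
rewrite -(big_mkord predT (fun i => \sum_(j < K) F i j)%N).
rewrite (@big_cat_nat _ _ _ m.+1) //= [X in (_ + X)%N]big_nat_cond.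
rewrite [X in (_ + X)%N]big1 ?addn0; last first.
  move=> i /andP[/andP[mi _] _]; apply: big1 => j _; rewrite /F; nia.
rewrite big_mkord /npartitions2 -sum1_card big_mkcond /=.
transitivity (\sum_(i < m.+1) \sum_(j < m.+1) F i j)%N.
  rewrite pair_bigA /=; apply: eq_bigr => -[i j] _.
  by rewrite inE /F /= eqz_nat; case: eqP.
apply: eq_bigr => i _; rewrite -[RHS](big_mkord predT (F i)).
rewrite (@big_cat_nat _ _ _ m.+1) //= big_mkord [X in (_ + X)%N]big_nat_cond.
rewrite [X in (_ + X)%N]big1 ?addn0 // => j /andP[/andP[mj _] _].
rewrite /F; nia.
Qed.

Lemma npartitions2_neg a b z : z < 0 -> npartitions2 a b z = 0%N.
Proof. by case: z. Qed.

Lemma sum_delta_nat K (P : nat -> bool) c :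
  (forall i, P i -> i = c) ->
  (\sum_(i < K) P i)%N = ((c < K) && P c)%N.
Proof.
move=> Pc; rewrite -(big_mkord predT (fun i => P i : nat)).
elim: K => [|K IH]; first by rewrite big_geq.
rewrite big_nat_recr //= IH; case PK: (P K).
  by rewrite -(Pc K PK) ltnn ltnSn PK.
case Pcc: (P c); rewrite ?andbF // !andbT addn0.
have neq_Kc : K <> c by move=> eKc; rewrite eKc Pcc in PK.
by congr nat_of_bool; lia.
Qed.

Lemma npartitions2_0 a b : (0 < a)%N -> (0 < b)%N -> npartitions2 a b 0 = 1%N.
Proof.
by move=> a_gt0 b_gt0; rewrite (@npartitions2E _ _ 1) // !big_ord1.
Qed.

(** The coefficient form of (1 - x^a) (1 - x^b) times the generating function
    being 1: removing a part a leaves the partitions into parts b alone, and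
    removing a part b from these leaves the empty one. *)
Lemma npartitions2_recurrence (a b : nat) (z : int) :
  (0 < a)%N -> (0 < b)%N ->
  (npartitions2 a b z + npartitions2 a b (z - a%:Z - b%:Z) =
   npartitions2 a b (z - a%:Z) + npartitions2 a b (z - b%:Z) + (z == 0))%N.
Proof.
move=> a_gt0 b_gt0; pose K := `|z|%N.+2.
rewrite !(@npartitions2E _ _ K) //; try lia.
pose G (w : int) := (\sum_(j < K) ((j * b)%:Z == w))%N.
pose N (w : int) := (\sum_(i < K) \sum_(j < K) ((i * a + j * b)%:Z == w))%N.
have NE w : w < K%:Z -> N w = (G w + N (w - a%:Z)%R)%N.
  move=> ltwK; rewrite /N [in LHS]/K [in RHS]/K big_ord_recl.
  congr (_ + _)%N; rewrite [RHS]big_ord_recr /= [X in (_ + X)%N]big1 ?addn0.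
    apply: eq_bigr => i _; apply: eq_bigr => j _; rewrite /bump /=.
    congr nat_of_bool; lia.
  by move=> j _; nia.
have GE w : w < K%:Z -> G w = (G (w - b%:Z)%R + (w == 0))%N.
  move=> ltwK; rewrite /G [in LHS]/K [in RHS]/K big_ord_recl.
  rewrite addnC; congr (_ + _)%N; last by rewrite mul0n eq_sym.
  rewrite [RHS]big_ord_recr /= [X in (_ + X)%N](_ : _ = 0)%N ?addn0.
    apply: eq_bigr => j _; rewrite /bump /=; congr nat_of_bool; lia.
  nia.
rewrite -/(N z) -/(N (z - a%:Z)) -/(N (z - b%:Z)) -/(N (z - a%:Z - b%:Z)).
rewrite NE; last lia.
rewrite [N (z - b%:Z)]NE; last lia.
rewrite [z - b%:Z - a%:Z]addrAC GE; last lia.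
ring.
Qed.

(** * The Gale Robinson quiver *)

Section GaleRobinsonQuiver.

Variables (v r t : nat).
Hypotheses (r_gt0 : (0 < r)%N) (lt_rt : (r < t)%N) (lt_rtv : (r + t < v)%N).

(** The arrow families of the quiver as conditions on the positions x and y,
    counted from 0. *)
Definition gr_arrows (x y : nat) : nat :=
  ((y == x + r) + (y == x + (v - r)) + (x == y + t) + (x == y + (v - t))
   + [&& r <= x, x < v - t & y == x + (t - r)]
   + [&& r <= x, x < t & y == x + (v - t - r)])%N.

(** Signed arrow counts: on them mutation involves no truncation, and they
    determine a reduced quiver. *)
Definition net_arrows (T : Type) (q : quiver T) (x y : T) : int :=
  (q x y)%:Z - (q y x)%:Z.

Definition gr_net (x y : nat) : int := (gr_arrows x y)%:Z - (gr_arrows y x)%:Z.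

Lemma sum_delta_interval m (P : nat -> bool) c :
  (forall i, P i -> i = c) ->
  (\sum_(1 <= i < m.+1) P i)%N = ((0 < c <= m) && P c)%N.
Proof.
move=> Pc; rewrite big_add1 big_mkord /=.
rewrite (@sum_delta_nat _ (fun i => P i.+1) c.-1) => [|i /Pc <- //].
case: c Pc => [|c] Pc //=; case: (P 1) (Pc 1%N) => [/(_ isT)|_] //.
by rewrite andbF.
Qed.

Lemma gale_robinsonE (x y : 'I_v) :
  gale_robinson r t x y = (gr_arrows x y - gr_arrows y x)%N.
Proof.
have arrowsE (a b : 'I_v) : forall s, s = (
    \sum_(1 <= i < (v - r).+1) ((a.+1 == i) && (b.+1 == i + r))
     + \sum_(1 <= j < r.+1) ((a.+1 == j) && (b.+1 == v - r + j))
     + \sum_(1 <= i < (v - t).+1) ((a.+1 == t + i) && (b.+1 == i))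
     + \sum_(1 <= j < t.+1) ((a.+1 == v - t + j) && (b.+1 == j))
     + \sum_(1 <= i < (v - r - t).+1) ((a.+1 == r + i) && (b.+1 == t + i))
     + \sum_(1 <= j < (t - r).+1) ((a.+1 == r + j) && (b.+1 == v - t + j)))%N ->
    s = gr_arrows a b.
  move=> s ->; have [lt_av lt_bv] := (ltn_ord a, ltn_ord b).
  rewrite (@sum_delta_interval _ _ a.+1); last by lia.
  rewrite (@sum_delta_interval _ _ a.+1); last by lia.
  rewrite (@sum_delta_interval _ _ b.+1); last by lia.
  rewrite (@sum_delta_interval _ _ b.+1); last by lia.
  rewrite (@sum_delta_interval _ _ (a.+1 - r)%N); last by lia.
  rewrite (@sum_delta_interval _ _ (a.+1 - r)%N); last by lia.
  rewrite /gr_arrows; do 5 ?[congr (_ + _)%N]; congr nat_of_bool; lia.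
by rewrite /gale_robinson /delete_2cycles (arrowsE x y _ erefl) (arrowsE y x _ erefl).
Qed.

Lemma gr_net_anti p p' : gr_net p p' = - gr_net p' p.
Proof. by rewrite /gr_net opprB. Qed.

Lemma gr_arrows_from0 p : gr_arrows 0 p = ((p == r) + (p == v - r))%N.
Proof.
rewrite /gr_arrows !add0n leqNgt r_gt0 /= !addn0.
have -> : (0 == p + t)%N = false by lia.
have -> : (0 == p + (v - t))%N = false by lia.
by rewrite !addn0.
Qed.

Lemma gr_arrows_to0 p : gr_arrows p 0 = ((p == t) + (p == v - t))%N.
Proof.
rewrite /gr_arrows !add0n.
have -> : (0 == p + r)%N = false by lia.
have -> : (0 == p + (v - r))%N = false by lia.
have -> : (0 == p + (t - r))%N = false by lia.
have -> : (0 == p + (v - t - r))%N = false by lia.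
by rewrite !andbF !addn0.
Qed.

Lemma gr_arrows0_disjoint p :
  (gr_arrows 0 p - gr_arrows p 0 = gr_arrows 0 p)%N /\
  (gr_arrows p 0 - gr_arrows 0 p = gr_arrows p 0)%N.
Proof.
rewrite gr_arrows_from0 gr_arrows_to0.
have [->|nr] := eqVneq p r.
  have -> : (r == t) = false by lia.
  have -> : (r == v - t)%N = false by lia.
  by rewrite sub0n subn0.
have [->|nvr] := eqVneq p (v - r)%N; last by rewrite sub0n subn0.
have -> : (v - r == t)%N = false by lia.
have -> : (v - r == v - t)%N = false by lia.
by rewrite sub0n subn0.
Qed.

Lemma shift_interval a b d p p' :
  ([&& a <= p.+1, p.+1 < b & p'.+1 == p.+1 + d] +
     ((p.+1 == b) && (a <= b) && (p'.+1 == b + d)) =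
   [&& a <= p, p < b & p' == p + d] + ((p.+1 == a) && (a <= b) && (p'.+1 == a + d)))%N.
Proof.
rewrite addSn eqSS; have [->|neq] := eqVneq p' (p + d)%N.
  rewrite -!addSn !eqn_add2r !andbT; case: (ltngtP p.+1 b) => ?; case: (ltngtP p.+1 a) => ?; lia.
rewrite !andbF.
have off c : (p.+1 == c) && (a <= b)%N && (p'.+1 == c + d)%N = false.
  by apply/negP => /andP[/andP[/eqP <- _]]; rewrite addSn eqSS (negPf neq).
by rewrite !off.
Qed.

(** The first four families depend only on y - x. The last two are intervals,
    and shifting an interval by one gains its left end and loses its right
    end: these ends account for the arrows that the mutation at 0 creates. *)
Lemma gr_arrows_shift p p' :
  (gr_arrows p.+1 p'.+1 + gr_arrows p.+1 0 * (p'.+1 == v - r) =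
   gr_arrows p p' + gr_arrows p'.+1 0 * (p.+1 == r))%N.
Proof.
rewrite [X in _ = (_ + X)%N]mulnC !gr_arrows_to0 mulnDl mulnDr !mulnb.
have := shift_interval r (v - t) (t - r) p p'.
have := shift_interval r t (v - t - r) p p'.
have -> : (r <= v - t)%N = true by lia.
have -> : (r <= t)%N = true by lia.
have -> : (t + (v - t - r) = v - r)%N by lia.
have -> : (r + (v - t - r) = v - t)%N by lia.
have -> : (v - t + (t - r) = v - r)%N by lia.
have -> : (r + (t - r) = t)%N by lia.
have eqSD x y c : (x.+1 == y.+1 + c)%N = (x == y + c)%N by rewrite addSn eqSS.
rewrite !andbT /gr_arrows (eqSD p' p r) (eqSD p' p (v - r)%N).
rewrite (eqSD p p' t) (eqSD p p' (v - t)%N).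
have sum_shift (Z A B C D E F G H : nat) : (A + E = C + G -> B + F = D + H ->
    Z + B + A + (E + F) = Z + D + C + (H + G))%N by lia.
exact: sum_shift.
Qed.

(** Mutating at position 0 and renaming p.+1 as p restores the quiver. *)
Lemma gr_net_shift p p' :
  gr_net p.+1 p'.+1 + (gr_arrows p.+1 0 * gr_arrows 0 p'.+1)%N%:Z
    - (gr_arrows p'.+1 0 * gr_arrows 0 p.+1)%N%:Z = gr_net p p'.
Proof.
rewrite /gr_net; have := gr_arrows_shift p p'; have := gr_arrows_shift p' p.
rewrite !gr_arrows_from0 !mulnDr.
have sum_shift (A A' B B' a b c d : nat) : (A' + b = B' + c)%N ->
    (A + a = B + d)%N ->
    A%:Z - A'%:Z + (c + a)%N%:Z - (d + b)%N%:Z = B%:Z - B'%:Z by lia.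
exact: sum_shift.
Qed.

(** The reversal of the arrows at the mutated vertex, which becomes the last
    one. *)
Lemma gr_net_last p : (p.+1 < v)%N -> gr_net v.-1 p = - gr_net 0 p.+1.
Proof.
move=> lt_pv; rewrite /gr_net gr_arrows_from0 gr_arrows_to0 /gr_arrows.
have -> : (p == v.-1 + r)%N = false by lia.
have -> : (p == v.-1 + (v - r))%N = false by lia.
have -> : (v.-1 < v - t)%N = false by lia.
have -> : (v.-1 < t)%N = false by lia.
have -> : (v.-1 == p + t)%N = (p.+1 == v - t)%N by lia.
have -> : (v.-1 == p + (v - t))%N = (p.+1 == t)%N by lia.
have -> : (v.-1 == p + r)%N = (p.+1 == v - r)%N by lia.
have -> : (v.-1 == p + (v - r))%N = (p.+1 == r)%N by lia.
have -> : (p == v.-1 + t)%N = false by lia.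
have -> : (p == v.-1 + (v - t))%N = false by lia.
have -> : [&& r <= p, p < v - t & v.-1 == p + (t - r)]%N = false by lia.
have -> : [&& r <= p, p < t & v.-1 == p + (v - t - r)]%N = false by lia.
rewrite !andbF !add0n !addn0; lia.
Qed.

End GaleRobinsonQuiver.

(** * Seeds along the cyclic mutation sequence *)

Section NetArrows.

Variables (T : eqType) (q : quiver T).

Lemma net_arrows_mutate_off k x y : x != k -> y != k ->
  net_arrows (mutate_quiver k q) x y =
    net_arrows q x y + (q x k * q k y)%N%:Z - (q y k * q k x)%N%:Z.
Proof. by move=> xk yk; rewrite /net_arrows !mutate_quiver_off //; lia. Qed.

Lemma net_arrows_mutate_at k x : reduced q ->
  net_arrows (mutate_quiver k q) k x = - net_arrows q k x.
Proof. by move=> qred; rewrite /net_arrows !mutate_quiver_at // opprB. Qed.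

Lemma net_arrows_anti x y : net_arrows q x y = - net_arrows q y x.
Proof. by rewrite /net_arrows opprB. Qed.

Lemma reduced_arrows x y (m m' : nat) : reduced q ->
  net_arrows q x y = m%:Z - m'%:Z -> q x y = (m - m')%N /\ q y x = (m' - m)%N.
Proof. by rewrite /net_arrows => /(_ x y)[] ->; lia. Qed.

End NetArrows.

Section GaleRobinsonSeeds.

Variables (K : fieldType) (v r t : nat).
Hypotheses (v_gt0 : (0 < v)%N) (r_gt0 : (0 < r)%N) (lt_rt : (r < t)%N).
Hypothesis (lt_rtv : (r + t < v)%N).
Variable (y : 'I_v -> K).

(** The vertex at position p after n steps, counted from the one to be
    mutated next. *)
Definition vertex n p : 'I_v := Ordinal (ltn_pmod (n + p) v_gt0).

Lemma cyclic_sequence_vertex n : cyclic_sequence v_gt0 n.+1 = vertex n 0.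
Proof. by apply: val_inj; rewrite /= addn0. Qed.

Lemma vertex_succ n p : vertex n.+1 p = vertex n p.+1.
Proof. by apply: val_inj; rewrite /= addnS. Qed.

Lemma vertex_last n : vertex n.+1 v.-1 = vertex n 0.
Proof. by apply: val_inj; rewrite /= addSnnS prednK // modnDr addn0. Qed.

Lemma vertex_inj n p p' : (p < v)%N -> (p' < v)%N ->
  (vertex n p == vertex n p') = (p == p').
Proof.
move=> ltpv ltp'v; rewrite -val_eqE /= eqn_modDl !modn_small //.
Qed.

Definition initial_label (x : 'I_v + 'I_v) : K :=
  if x is inr i then y i else 1.

Definition gr_seed n : quiver ('I_v + 'I_v) * ('I_v + 'I_v -> K) :=
  run (framed (gale_robinson r t), initial_label)
    [seq inl (cyclic_sequence v_gt0 k) | k <- iota 1 n].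

Lemma gr_seedS n : gr_seed n.+1 = mutate (gr_seed n) (inl (vertex n 0)).
Proof.
have := iotaD 1 n 1; rewrite addn1 => iotaS.
by rewrite /gr_seed -cyclic_sequence_vertex iotaS map_cat /run foldl_cat add1n.
Qed.

(** With k = n + v this is F_(n+1); the shift of indices by v - 1 leaves room
    for the initial labels, so that the vertex at position p after n steps
    has label [gr_value (n + p)]. *)
Definition gr_value k : K :=
  if (k < v)%N then 1 else (gr_seed (k - v).+1).2 (inl (vertex (k - v) 0)).

Lemma gr_value_small k : (k < v)%N -> gr_value k = 1.
Proof. by rewrite /gr_value => ->. Qed.

Lemma gr_value_step n : gr_value (n + v) = (gr_seed n.+1).2 (inl (vertex n 0)).
Proof. by rewrite /gr_value ltnNge leq_addl addnK. Qed.

Let s (z : int) : int := (npartitions2 r (v - r) z)%:Z.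

(** The arrows from the frozen vertex i to the vertex at position p after n
    steps: the initial arrow, one contribution from each of the two earlier
    mutations at distance r and v - r that point to this vertex, if they have
    taken place, and the reversed arrows left by its own last mutation. *)
Definition c_vector n p i : int :=
  (n + p == i)%N%:Z + (if (p < r)%N then s ((n + p)%N%:Z - r%:Z - i%:Z) else 0)
  + (if (p < v - r)%N then s ((n + p)%N%:Z - (v - r)%N%:Z - i%:Z) else 0)
  - s ((n + p)%N%:Z - v%:Z - i%:Z).

Lemma c_vector0 n i : c_vector n 0 i = s (n%:Z - i%:Z).
Proof.
have := @npartitions2_recurrence r (v - r) (n%:Z - i%:Z) r_gt0.
rewrite /c_vector /s addn0 r_gt0 subn_gt0.
have -> : (n == i) = (n%:Z - i%:Z == 0) by lia.
have -> : (r < v)%N by lia.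
have -> : n%:Z - i%:Z - r%:Z - (v - r)%N%:Z = n%:Z - v%:Z - i%:Z by lia.
have -> : n%:Z - i%:Z - r%:Z = n%:Z - r%:Z - i%:Z by lia.
have -> : n%:Z - i%:Z - (v - r)%N%:Z = n%:Z - (v - r)%N%:Z - i%:Z by lia.
by move=> /(_ isT); lia.
Qed.

Lemma c_vectorS n p i : (p.+1 < v)%N ->
  c_vector n.+1 p i =
    c_vector n p.+1 i + s (n%:Z - i%:Z) * ((p.+1 == r) + (p.+1 == v - r))%N%:Z.
Proof.
move=> ltpv; rewrite /c_vector addSnnS.
have [e|ne] := eqVneq p.+1 r.
  have -> : (p.+1 == v - r)%N = false by lia.
  have -> : (p.+1 < r)%N = false by lia.
  have -> : (p < r)%N = true by lia.
  have -> : (p.+1 < v - r)%N = true by lia.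
  have -> : (p < v - r)%N = true by lia.
  have -> : (n + p.+1)%N%:Z - r%:Z - i%:Z = n%:Z - i%:Z by lia.
  by rewrite mulr1; ring.
have -> : (p.+1 < r)%N = (p < r)%N by lia.
have [e|ne'] := eqVneq p.+1 (v - r)%N.
  have -> : (p.+1 < v - r)%N = false by lia.
  have -> : (p < v - r)%N = true by lia.
  have -> : (n + p.+1)%N%:Z - (v - r)%N%:Z - i%:Z = n%:Z - i%:Z by lia.
  by rewrite mulr1; ring.
have -> : (p.+1 < v - r)%N = (p < v - r)%N by lia.
by rewrite mulr0 addr0.
Qed.

Lemma c_vector_last n (i : 'I_v) : c_vector n.+1 v.-1 i = - s (n%:Z - i%:Z).
Proof.
have lt_iv := ltn_ord i; rewrite /c_vector.
have -> : (n.+1 + v.-1 = n + v)%N by lia.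
have -> : (n + v == i)%N = false by lia.
have -> : (v.-1 < r)%N = false by lia.
have -> : (v.-1 < v - r)%N = false by lia.
have -> : (n + v)%N%:Z - v%:Z - i%:Z = n%:Z - i%:Z by lia.
by rewrite !add0r.
Qed.

Lemma c_vector_initial p (i : 'I_v) : (p < v)%N ->
  c_vector 0 p i = (p == i)%:Z.
Proof.
move=> ltpv; rewrite /c_vector add0n.
have s_neg z : z < 0 -> s z = 0 by move=> z_lt0; rewrite /s npartitions2_neg.
have -> : (if (p < r)%N then s (p%:Z - r%:Z - i%:Z) else 0) = 0.
  by case: ifP => // ltpr; apply: s_neg; lia.
have -> : (if (p < v - r)%N then s (p%:Z - (v - r)%N%:Z - i%:Z) else 0) = 0.
  by case: ifP => // ltpr; apply: s_neg; lia.
have -> : s (p%:Z - v%:Z - i%:Z) = 0 by apply: s_neg; lia.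
by rewrite oppr0 !addr0.
Qed.

Lemma gr_seed_reduced n : reduced (gr_seed n).1.
Proof.
case: n => [|n]; last by rewrite gr_seedS; apply: mutate_quiver_reduced.
move=> [a|i] [b|j] /=; try by [left | right].
rewrite /gale_robinson /delete_2cycles.
by set A := (\sum_(1 <= i < _) _ + _ + _ + _ + _ + _)%N;
   set B := (\sum_(1 <= i < _) _ + _ + _ + _ + _ + _)%N; lia.
Qed.

Lemma position_cases p : (p < v)%N -> p = v.-1 \/ (p.+1 < v)%N.
Proof. lia. Qed.

Lemma gr_seed_base n p p' : (p < v)%N -> (p' < v)%N ->
  net_arrows (gr_seed n).1 (inl (vertex n p)) (inl (vertex n p')) = gr_net v r t p p'.
Proof.
elim: n p p' => [|n IH] p p' ltpv ltp'v.
  rewrite /net_arrows /= !gale_robinsonE //= !add0n !modn_small //.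
  by rewrite /gr_net; lia.
have red := gr_seed_reduced n.
have v1 : (0 < v)%N by [].
rewrite gr_seedS; set k := inl (vertex n 0); set Q := (gr_seed n).1.
have at0 p1 : (p1 < v)%N -> Q k (inl (vertex n p1)) = gr_arrows v r t 0 p1 /\
    Q (inl (vertex n p1)) k = gr_arrows v r t p1 0.
  move=> ltp1; have [d1 d2] := gr_arrows0_disjoint r_gt0 lt_rt lt_rtv p1.
  have := reduced_arrows red (IH 0%N p1 v_gt0 ltp1).
  by rewrite -/k -/Q d1 d2.
have neqk p1 : (p1.+1 < v)%N -> inl (vertex n p1.+1) != k :> 'I_v + 'I_v.
  move=> ltp1; rewrite /k (inj_eq (@inl_inj _ _)) vertex_inj //.
have rot p1 : (p1.+1 < v)%N -> gr_net v r t v.-1 p1 = - gr_net v r t 0 p1.+1.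
  exact: gr_net_last.
have [->|ltp] := position_cases ltpv; have [->|ltp'] := position_cases ltp'v.
- by rewrite /net_arrows /gr_net !subrr.
- rewrite vertex_last vertex_succ net_arrows_mutate_at // IH // rot //.
- rewrite vertex_last vertex_succ net_arrows_anti net_arrows_mutate_at // IH //.
  by rewrite [RHS]gr_net_anti rot.
rewrite !vertex_succ net_arrows_mutate_off ?neqk // IH //.
have [e1 e2] := at0 _ ltp; have [e3 e4] := at0 _ ltp'.
by rewrite -/k -/Q e1 e2 e3 e4 gr_net_shift.
Qed.

Lemma gr_seed_at0 n p : (p < v)%N ->
  (gr_seed n).1 (inl (vertex n 0)) (inl (vertex n p)) = ((p == r) + (p == v - r))%N /\
  (gr_seed n).1 (inl (vertex n p)) (inl (vertex n 0)) = ((p == t) + (p == v - t))%N.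
Proof.
move=> ltpv; have red := gr_seed_reduced n.
rewrite -(@gr_arrows_from0 v r t) // -(@gr_arrows_to0 v r t) //.
have [d1 d2] := gr_arrows0_disjoint r_gt0 lt_rt lt_rtv p.
by have [-> ->] := reduced_arrows red (gr_seed_base n v_gt0 ltpv).
Qed.

Lemma gr_seed_frozen n p (i : 'I_v) : (p < v)%N ->
  net_arrows (gr_seed n).1 (inr i) (inl (vertex n p)) = c_vector n p i.
Proof.
elim: n p => [|n IH] p ltpv.
  rewrite c_vector_initial // /net_arrows /= subr0 -val_eqE /= add0n.
  by rewrite modn_small // eq_sym.
have red := gr_seed_reduced n.
rewrite gr_seedS; set k := inl (vertex n 0); set Q := (gr_seed n).1.
have [ik ki] : Q (inr i) k = npartitions2 r (v - r) (n%:Z - i%:Z) /\ Q k (inr i) = 0%N.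
  have := @reduced_arrows _ Q (inr i) k (npartitions2 r (v - r) (n%:Z - i%:Z)) 0 red.
  by rewrite subn0 sub0n subr0; apply; rewrite IH // c_vector0.
have [->|ltp] := position_cases ltpv.
  rewrite vertex_last net_arrows_anti net_arrows_mutate_at // opprK.
  by rewrite net_arrows_anti IH // c_vector0 c_vector_last.
rewrite vertex_succ net_arrows_mutate_off //; last first.
  by rewrite /k (inj_eq (@inl_inj _ _)) vertex_inj.
rewrite IH // c_vectorS // -/k -/Q ki muln0 subr0 ik.
by have [] := gr_seed_at0 n ltp; rewrite -/k -/Q => -> _; rewrite PoszM.
Qed.

Lemma gr_seed_frozen0 n i :
  (gr_seed n).1 (inr i) (inl (vertex n 0)) = npartitions2 r (v - r) (n%:Z - i%:Z) /\
  (gr_seed n).1 (inl (vertex n 0)) (inr i) = 0%N.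
Proof.
have red := gr_seed_reduced n.
have := @reduced_arrows _ _ (inr i) (inl (vertex n 0)) (npartitions2 r (v - r) (n%:Z - i%:Z)) 0 red.
by rewrite subn0 sub0n subr0; apply; rewrite gr_seed_frozen // c_vector0.
Qed.

Lemma gr_seed_label n p : (p < v)%N ->
  (gr_seed n).2 (inl (vertex n p)) = gr_value (n + p).
Proof.
elim: n p => [|n IH] p ltpv; first by rewrite /= add0n gr_value_small.
have [->|ltp] := position_cases ltpv.
  rewrite vertex_last -gr_value_step; congr gr_value; lia.
rewrite vertex_succ gr_seedS /= relabel_neq; first by rewrite IH // addSnnS.
by rewrite (inj_eq (@inl_inj _ _)) vertex_inj.
Qed.

Lemma gr_seed_frozen_label n i : (gr_seed n).2 (inr i) = y i.
Proof. by elim: n => // n IH; rewrite gr_seedS /= relabel_neq. Qed.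

Lemma prod_vertex n (f : 'I_v -> K) : \prod_a f a = \prod_(p < v) f (vertex n p).
Proof.
rewrite (reindex_inj (h := fun p : 'I_v => vertex n p)) // => p p' /eqP.
by rewrite vertex_inj // => /eqP/val_inj.
Qed.

Lemma prod_indicator (f : nat -> K) c : (c < v)%N ->
  \prod_(p < v) f p ^+ (p == c :> nat) = f c.
Proof.
move=> ltcv; rewrite (bigD1 (Ordinal ltcv)) //= eqxx expr1 big1 ?mulr1 //.
move=> p; rewrite -val_eqE /= => /negPf->; exact: expr0.
Qed.

Theorem gr_value_recurrence n :
  gr_value (n + v) =
    (\prod_i y i ^+ npartitions2 r (v - r) (n%:Z - i%:Z)
       * (gr_value (n + t) * gr_value (n + (v - t)))
     + gr_value (n + r) * gr_value (n + (v - r))) / gr_value n.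
Proof.
rewrite gr_value_step gr_seedS /= relabel_id /exchange gr_seed_label // addn0.
rewrite !big_sumType /=.
have pairE c d : (c < v)%N -> (d < v)%N ->
    \prod_(p < v) gr_value (n + p) ^+ ((p == c :> nat) + (p == d :> nat))
    = gr_value (n + c) * gr_value (n + d).
  move=> ltc ltd; under eq_bigr do rewrite exprD.
  by rewrite big_split /= !(prod_indicator (fun p => gr_value (n + p))).
have -> : \prod_a (gr_seed n).2 (inl a)
      ^+ (gr_seed n).1 (inl a) (inl (vertex n 0))
    = gr_value (n + t) * gr_value (n + (v - t)).
  rewrite (prod_vertex n) -pairE; [|lia|lia]; apply: eq_bigr => p _.
  by rewrite gr_seed_label // (gr_seed_at0 n (ltn_ord p)).2.
have -> : \prod_a (gr_seed n).2 (inl a)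
      ^+ (gr_seed n).1 (inl (vertex n 0)) (inl a)
    = gr_value (n + r) * gr_value (n + (v - r)).
  rewrite (prod_vertex n) -pairE; [|lia|lia]; apply: eq_bigr => p _.
  by rewrite gr_seed_label // (gr_seed_at0 n (ltn_ord p)).1.
congr (_ / _); rewrite mulrC; congr (_ * _ + _).
  by apply: eq_bigr => i _; rewrite gr_seed_frozen_label (gr_seed_frozen0 n i).1.
by rewrite [X in _ * X]big1 ?mulr1 // => i _; rewrite (gr_seed_frozen0 n i).2.
Qed.

End GaleRobinsonSeeds.

(** * Polynomials in several variables *)

Section MultivariatePolynomials.

Lemma mpoly0_const (p : {mpoly rat[0]}) : p = (p@_0%MM)%:MP.
Proof.
apply/mpolyP => m; have -> : m = 0%MM by apply/mnmP; case.
by rewrite mcoeffC eqxx mulr1.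
Qed.

(** Induction on the number of variables: for fixed positive values of the
    others, a polynomial in the last variable vanishes at all positive
    numbers, so its coefficients vanish. *)
Lemma mpoly_zero_positive n (p : {mpoly rat[n]}) :
  (forall x, positive x -> p.@[x] = 0) -> p = 0.
Proof.
elim: n p => [|n IH] p p0.
  have := p0 (fun=> 1) (fun=> ltr01); rewrite [p]mpoly0_const mevalC => ->.
  by rewrite mpolyC0.
pose low (m : 'X_{1..n.+1}) := [multinom m (widen_ord (leqnSn n) i) | i < n].
pose pk k : {mpoly rat[n]} :=
  \sum_(m <- msupp p | m ord_max == k) p@_m *: 'X_[low m].
have pk0 k : pk k = 0.
  apply: IH => x x_gt0.
  pose q : {poly rat} := \poly_(k < msize p) (pk k).@[x].
  have qE z : 0 < z -> q.[z] = 0.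
    move=> z_gt0; pose xz (i : 'I_n.+1) := if unlift ord_max i is Some j then x j else z.
    have xz_gt0 : positive xz by move=> i; rewrite /xz; case: unlift.
    rewrite -(p0 xz xz_gt0) horner_poly mevalE.
    transitivity (\sum_(k < msize p) \sum_(m <- msupp p | m ord_max == k)
        p@_m * \prod_i xz i ^+ m i).
      apply: eq_bigr => l _; rewrite raddf_sum mulr_suml /=.
      apply: eq_bigr => m /eqP <-; rewrite mevalZ mevalX -mulrA; congr (_ * _).
      rewrite big_ord_recr /=; congr (_ * _).
        apply: eq_bigr => i _; rewrite mnmE /xz.
        have -> : widen_ord (leqnSn n) i = lift ord_max i.
          by apply: val_inj; rewrite /= /bump leqNgt ltn_ord.
        by rewrite liftK.
      by rewrite /xz unlift_none.
    rewrite (exchange_big_dep predT) //= big_seq [RHS]big_seq.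
    apply: eq_bigr => m m_supp.
    have lt_m : (m ord_max < msize p)%N.
      apply: leq_ltn_trans (msize_mdeg_lt m_supp).
      by rewrite mdegE (bigD1 ord_max) //= leq_addr.
    by rewrite (big_pred1 (Ordinal lt_m)).
  have q0 : q = 0 by apply: (@poly_zero_beyond _ 0).
  have [ltk|gek] := ltnP k (msize p).
    by have := coef_poly (msize p) (fun k => (pk k).@[x]) k; rewrite -/q q0 coef0 ltk.
  rewrite /pk big1_seq ?meval0 // => m /andP[/eqP mk m_supp].
  have := msize_mdeg_lt m_supp; rewrite ltnNge => /negP[].
  apply: leq_trans gek _; rewrite -mk.
  by rewrite mdegE (bigD1 ord_max) //= leq_addr.
apply/mpolyP => m; rewrite mcoeff0; apply/eqP/contraT => pm_neq0.
have := congr1 (fun q => q@_(low m)) (pk0 (m ord_max)).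
rewrite mcoeff0 raddf_sum /=.
rewrite big_mkcond (bigD1_seq m) ?msupp_uniq ?mcoeff_msupp //= eqxx.
rewrite mcoeffZ mcoeffX eqxx mulr1 big1 ?addr0.
  by move=> pm_eq0; rewrite pm_eq0 eqxx in pm_neq0.
move=> m' m'm; case: eqP => // emax; rewrite mcoeffZ mcoeffX.
case: eqP => [elow|]; last by rewrite mulr0.
case/eqP: m'm; apply/mnmP => i; case: (unliftP ord_max i) => [j|] -> //.
move/mnmP/(_ j): elow; rewrite !mnmE.
have -> // : widen_ord (leqnSn n) j = lift ord_max j.
by apply: val_inj; rewrite /= /bump leqNgt ltn_ord.
Qed.

Lemma mcoeffM_le n (p q : {mpoly rat[n]}) m :
  (p * q)@_m = \sum_(k : 'X_{1..n < (mdeg m).+1} | (k <= m)%MM)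
    p@_k * q@_(m - k).
Proof. exact: mcoeff_poly_mul_lin. Qed.

(** Multiplication by a series with nonzero constant term is triangular for
    divisibility of monomials, hence injective on any set of monomials closed
    under divisors. It serves for the monomials of small degree and for those
    that are not multiples of a given one. *)
Lemma mcoeff_cancel n (Z : 'X_{1..n} -> Prop) (p u : {mpoly rat[n]}) :
  (forall m k, (k <= m)%MM -> Z m -> Z k) -> u@_0%MM != 0 ->
  (forall m, Z m -> (p * u)@_m = 0) -> forall m, Z m -> p@_m = 0.
Proof.
move=> Zdown u0 pu0 m; move: {2}(mdeg m).+1 (ltnSn (mdeg m)) => d.
elim: d m => // d IH m lt_md Zm; have := pu0 m Zm.
have ltmm : (mdeg m < (mdeg m).+1)%N by [].
rewrite mcoeffM_le (bigD1 (BMultinom ltmm)) /=; last exact: lepm_refl.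
rewrite big1 ?addr0 => [/eqP|k /andP[le_km neq_km]].
  have -> : (m - m)%MM = 0%MM by apply/mnmP => i; rewrite mnmBE subnn mnm0E.
  by rewrite mulf_eq0 (negPf u0) orbF => /eqP.
have lt_km : (mdeg k < mdeg m)%N.
  rewrite -[in X in (_ < X)%N](submK le_km) mdegD -[X in (X < _)%N]add0n.
  rewrite ltn_add2r lt0n mdeg_eq0.
  apply: contra neq_km => /eqP e; apply/eqP/val_inj => /=.
  by rewrite -[RHS](submK le_km) e add0m.
by rewrite (IH _ (leq_trans lt_km lt_md) (Zdown _ _ le_km Zm)) mul0r.
Qed.

Lemma mpoly_monomial_dvd n (a : 'X_{1..n}) (p : {mpoly rat[n]}) :
  (forall m, ~~ (a <= m)%MM -> p@_m = 0) -> exists q, p = 'X_[a] * q.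
Proof.
move=> pa; exists (\sum_(m <- msupp p) p@_m *: 'X_[m - a]).
rewrite [LHS]mpolyE mulr_sumr big_seq [RHS]big_seq; apply: eq_bigr => m.
rewrite mcoeff_msupp => pm; have am : (a <= m)%MM.
  by apply: contraR pm => /pa ->.
by rewrite -scalerAr -mpolyXD addmC submK.
Qed.

Lemma mcoeff_monomial_mul n (a : 'X_{1..n}) (p : {mpoly rat[n]}) m :
  ~~ (a <= m)%MM -> ('X_[a] * p)@_m = 0.
Proof.
move=> am; rewrite mcoeffM_le big1 // => k km.
rewrite mcoeffX; case: eqP => [e|]; last by rewrite mul0r.
by rewrite e km in am.
Qed.

Lemma monomial_quotient n (a : 'X_{1..n}) (g u p : {mpoly rat[n]}) :
  u@_0%MM != 0 -> g * u = 'X_[a] * p -> exists q, g = 'X_[a] * q.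
Proof.
move=> u0 gu; apply: mpoly_monomial_dvd => m am.
apply: (@mcoeff_cancel _ (fun m => ~~ (a <= m)%MM) g u) => //.
  by move=> m1 k le_km; apply: contra => /lepm_trans; apply.
by move=> m1 am1; rewrite gu mcoeff_monomial_mul.
Qed.

(** With the labels indexed by I set to 1, the denominator of a Laurent
    function is a monomial in the remaining variables. *)
Lemma laurent_mpoly n (I : Type) (g : (I + 'I_n -> rat) -> rat) : laurent g ->
  exists a, exists p : {mpoly rat[n]}, forall y, positive y ->
    g (fun x => if x is inr i then y i else 1) * 'X_[a].@[y] = p.@[y].
Proof.
elim=> {g} [c|k|k|g h _ [a [p pE]] _ [b [q qE]]
    |g h _ [a [p pE]] _ [b [q qE]]|g h gh _ [a [p pE]]].
- by exists 0%MM, c%:MP => y _; rewrite mpolyX0 meval1 mulr1 mevalC.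
- case: k => [k|i].
    by exists 0%MM, 1 => y _; rewrite mpolyX0 meval1 mulr1.
  by exists 0%MM, 'X_i => y _; rewrite mpolyX0 meval1 mulr1 mevalXU.
- case: k => [k|i].
    by exists 0%MM, 1 => y _; rewrite mpolyX0 meval1 mulr1 invr1.
  exists U_(i)%MM, 1 => y y_gt0; rewrite mevalXU meval1 mulVf //.
  exact: lt0r_neq0.
- exists (a + b)%MM, (p * 'X_[b] + q * 'X_[a]) => y y_gt0.
  by rewrite mpolyXD mevalD !mevalM -pE // -qE //; ring.
- exists (a + b)%MM, (p * q) => y y_gt0.
  by rewrite mpolyXD !mevalM -pE // -qE //; ring.
exists a, p => y y_gt0; rewrite -pE //; congr (_ * _); apply/esym/gh.
by case.
Qed.

End MultivariatePolynomials.

(** * Binomial coefficients and truncated power series *)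

Section Vandermonde.

Definition gbinom (a : rat) (k : nat) : rat := \prod_(l < k) (a - l%:R) / k`!%:R.

Lemma gbinom0 a : gbinom a 0 = 1.
Proof. by rewrite /gbinom big_ord0 fact0 divr1. Qed.

Lemma gbinomS a k : k.+1%:R * gbinom a k.+1 = (a - k%:R) * gbinom a k.
Proof.
rewrite /gbinom big_ord_recr /= factS natrM.
have k1 : (k.+1%:R : rat) != 0 by rewrite pnatr_eq0.
have kf : (k`!%:R : rat) != 0 by rewrite pnatr_eq0 -lt0n fact_gt0.
move: (\prod_(i < k) _) (k.+1%:R) (k`!%:R) (k%:R) k1 kf => P s f c s0 f0.
by field; rewrite s0 f0.
Qed.

Lemma gbinom_zeroS k : gbinom 0 k.+1 = 0.
Proof. by rewrite /gbinom big_ord_recl subrr mul0r mul0r. Qed.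

Lemma gbinom1_1 : gbinom 1 1 = 1.
Proof. by rewrite /gbinom big_ord1 subr0 divr1. Qed.

Lemma gbinom1_ge2 k : gbinom 1 k.+2 = 0.
Proof. by rewrite /gbinom !big_ord_recl /= subrr mul0r mulr0 mul0r. Qed.

(** Vandermonde's identity. Multiplying by n.+1 = k + (n.+1 - k) and
    absorbing each factor into one of the two binomials reduces it to the
    case of n. *)
Lemma gbinomD a b n :
  gbinom (a + b) n = \sum_(k < n.+1) gbinom a k * gbinom b (n - k).
Proof.
elim: n => [|n IH]; first by rewrite big_ord1 subnn !gbinom0 mulr1.
have n1 : (n.+1%:R : rat) != 0 by rewrite pnatr_eq0.
apply: (mulfI n1); rewrite gbinomS IH.
transitivity (\sum_(k < n.+2) k%:R * gbinom a k * gbinom b (n.+1 - k)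
   + \sum_(k < n.+2) gbinom a k * ((n.+1 - k)%:R * gbinom b (n.+1 - k))).
  rewrite [X in _ = X + _]big_ord_recl mul0r mul0r add0r.
  rewrite [X in _ = _ + X]big_ord_recr /= subnn mul0r mulr0 addr0.
  rewrite -big_split mulr_sumr; apply: eq_bigr => k _ /=.
  rewrite gbinomS /bump /= subSS subSn -1?ltnS ?ltn_ord // gbinomS.
  rewrite natrB -1?ltnS ?ltn_ord //; ring.
rewrite -big_split mulr_sumr; apply: eq_bigr => k _ /=.
by rewrite [n.+1%:R](_ : _ = k%:R + (n.+1 - k)%:R) ?[RHS]mulrDl -?natrD ?subnKC -1?ltnS //; ring.
Qed.

End Vandermonde.

Section Truncation.

Variable (v : nat).
Implicit Types (p q : {mpoly rat[v]}) (D : nat).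

(** Equality modulo the monomials of degree at least D, the form in which
    identities of formal power series are used. *)
Definition eq_below D p q := forall m, (mdeg m < D)%N -> p@_m = q@_m.

Lemma eq_below_refl D p : eq_below D p p. Proof. by []. Qed.

Lemma eq_below_sym D p q : eq_below D p q -> eq_below D q p.
Proof. by move=> pq m /pq. Qed.

Lemma eq_below_trans D q p p' :
  eq_below D p q -> eq_below D q p' -> eq_below D p p'.
Proof. by move=> pq qp m ltmD; rewrite pq ?qp. Qed.

Lemma eq_belowD D p q p' q' :
  eq_below D p q -> eq_below D p' q' -> eq_below D (p + p') (q + q').
Proof. by move=> pq pq' m ltmD; rewrite !mcoeffD pq ?pq'. Qed.

Lemma eq_below_sum D I (r : seq I) (P : pred I) (f g : I -> {mpoly rat[v]}) :
  (forall i, P i -> eq_below D (f i) (g i)) ->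
  eq_below D (\sum_(i <- r | P i) f i) (\sum_(i <- r | P i) g i).
Proof.
move=> fg m ltmD; rewrite !raddf_sum /=; apply: eq_bigr => i Pi.
exact: fg.
Qed.

Lemma eq_below_sum0 D I (r : seq I) (P : pred I) (f : I -> {mpoly rat[v]}) :
  (forall i, P i -> eq_below D (f i) 0) ->
  eq_below D (\sum_(i <- r | P i) f i) 0.
Proof.
move=> f0 m ltmD; rewrite raddf_sum mcoeff0 big1 // => i Pi.
by rewrite /= f0 ?mcoeff0.
Qed.

Lemma eq_belowM D p q p' q' :
  eq_below D p q -> eq_below D p' q' -> eq_below D (p * p') (q * q').
Proof.
move=> pq pq' m ltmD; rewrite !mcoeffM_le; apply: eq_bigr => k le_km.
have le_deg := mdegD (m - k) k; rewrite submK // in le_deg.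
by rewrite pq ?pq' //; lia.
Qed.

Lemma eq_belowZ D c p q : eq_below D p q -> eq_below D (c *: p) (c *: q).
Proof. by move=> pq m ltmD; rewrite !mcoeffZ pq. Qed.

Lemma monomial_below D a k p : (0 < mdeg a)%N -> (D <= k)%N ->
  eq_below D ('X_[a] ^+ k * p) 0.
Proof.
move=> a_gt0 leDk m ltmD; rewrite mpolyXn mcoeff0 mcoeff_monomial_mul //.
apply/negP => le_am.
have := mdegD (m - a *+ k) (a *+ k); rewrite submK // mdegMn; nia.
Qed.

(** A polynomial with nonzero constant term is invertible as a power series. *)
Lemma eq_below_cancel D p q u : u@_0%MM != 0 ->
  eq_below D (p * u) (q * u) -> eq_below D p q.
Proof.
move=> u0 pq m ltmD; apply/eqP; rewrite -subr_eq0 -mcoeffB; apply/eqP.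
apply: (@mcoeff_cancel _ (fun m => mdeg m < D)%N _ u) => //.
  move=> m1 k le_km; apply: leq_ltn_trans.
  by rewrite -(submK le_km) mdegD leq_addl.
by move=> m1 ltm1; rewrite mulrBl mcoeffB pq ?subrr.
Qed.

End Truncation.

Lemma sum_triangle (R : zmodType) (M : nat) (F : nat -> nat -> R) :
  \sum_(k < M) \sum_(l < M - k) F k l =
  \sum_(K < M) \sum_(k < K.+1) F k (K - k)%N.
Proof.
transitivity (\sum_(0 <= k < M) \sum_(k <= K < M) F k (K - k)%N).
  rewrite big_mkord; apply: eq_bigr => k _.
  rewrite -[X in \sum_(X <= _ < M) _]add0n big_addn big_mkord; apply: eq_bigr => l _.
  by rewrite addnK.
transitivity (\sum_(0 <= k < M) \sum_(0 <= K < M | (k <= K)%N) F k (K - k)%N).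
  rewrite big_nat [RHS]big_nat; apply: eq_bigr => k /andP[_ ltkM].
  by rewrite (big_nat_widenl k 0%N) //; apply: eq_bigl => K; rewrite andTb.
rewrite (exchange_big_dep_nat xpredT) //= big_mkord; apply: eq_bigr => K _.
rewrite -[RHS](big_mkord xpredT (fun k => F k (K - k)%N)).
by rewrite (big_nat_widen 0 K.+1 M).
Qed.

(** * The word series of a weight *)

Section WordSeries.

Variables (v D : nat) (b : nat -> nat -> rat) (e : nat -> 'X_{1..v}).
Hypothesis e_gt0 : forall N, (0 < N)%N -> (0 < mdeg (e N))%N.

(** The sum over all words in the letters 1..N, grouped by the multiplicity k
    of the largest letter, whose k occurrences add k * b z N to the weight of
    each smaller letter z. Multiplicities are cut at D.+1: larger ones only
    give monomials of degree at least D, and D.+2 terms are enough to contain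
    the multiplicities 0 and 1 for every D. *)
Fixpoint series (N : nat) (a : nat -> rat) : {mpoly rat[v]} :=
  if N is N'.+1 then
    \sum_(k < D.+2) gbinom (a N) k *:
      ('X_[e N] ^+ k * series N' (fun z => a z + k%:R * b z N))
  else 1.

Lemma eq_series N a a' :
  (forall z, (0 < z <= N)%N -> a z = a' z) -> series N a = series N a'.
Proof.
elim: N a a' => [|N IH] a a' aa' //=; apply: eq_bigr => k _.
rewrite aa' ?ltnSn //; congr (_ *: (_ * _)); apply: IH => z zN.
by rewrite aa' //; lia.
Qed.

Lemma series_top0 N a : a N.+1 = 0 -> series N.+1 a = series N a.
Proof.
move=> aN /=; rewrite big_ord_recl /= aN gbinom0 scale1r expr0 mul1r.
rewrite big1 ?addr0 => [|k _]; last by rewrite /bump gbinom_zeroS scale0r.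
by apply: eq_series => z _; rewrite mul0r addr0.
Qed.

Lemma series_widen N M a : (N <= M)%N ->
  (forall z, (N < z <= M)%N -> a z = 0) -> series M a = series N a.
Proof.
elim: M => [|M IH]; first by rewrite leqn0 => /eqP ->.
rewrite leq_eqVlt => /orP[/eqP -> //|ltNM] a0.
rewrite series_top0; last by rewrite a0 //; lia.
by apply: IH => // z zM; apply: a0; lia.
Qed.

(** Binomials with upper entry 0 or 1 leave only the multiplicities 0 and 1
    of the largest letter, and the empty word in the first case. *)
Lemma series_unit N a : a N.+1 = 1 -> (forall z, (z <= N)%N -> a z = 0) ->
  series N.+1 a = 1 + 'X_[e N.+1] * series N (b^~ N.+1).
Proof.
move=> aN a0 /=; rewrite !big_ord_recl aN /= gbinom0 !scale1r expr0 mul1r.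
rewrite gbinom1_1 scale1r expr1.
rewrite (@series_widen 0 N) //=; last by move=> z zN; rewrite a0 ?mul0r ?addr0 //; lia.
congr (_ + _); rewrite big1 ?addr0 => [|k _]; last first.
  by rewrite gbinom1_ge2 scale0r.
by congr (_ * _); apply: eq_series => z zN; rewrite a0 ?add0r ?mul1r //; lia.
Qed.

(** Induction on the largest letter: grouping the pairs of multiplicities (k,
    l) by their sum, both factors see the same shift of their weights by k +
    l in total, and Vandermonde's identity adds up the binomials. The pairs
    whose sum exceeds the truncation have degree at least D. *)
Lemma seriesD N a a' :
  eq_below D (series N (fun z => a z + a' z)) (series N a * series N a').
Proof.
elim: N a a' => [|N IH] a a'; first by rewrite /= mulr1.
pose X := 'X_[e N.+1] : {mpoly rat[v]}.
pose R k := series N (fun z => a z + a' z + k%:R * b z N.+1).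
pose F k l := (gbinom (a N.+1) k * gbinom (a' N.+1) l) *: (X ^+ (k + l) * R (k + l)%N).
apply: (@eq_below_trans _ _ (\sum_(K < D.+2) \sum_(k < K.+1) F k (K - k)%N)).
  apply: eq_below_sum => K _; rewrite gbinomD scaler_suml.
  apply: eq_below_sum => k _; rewrite /F subnKC -1?ltnS //.
rewrite -sum_triangle /= mulr_suml; apply: eq_below_sum => k _.
rewrite mulr_sumr.
pose c l := gbinom (a N.+1) k * gbinom (a' N.+1) l.
pose H l := c l *: (X ^+ (k + l) *
    (series N (fun z => a z + k%:R * b z N.+1) *
     series N (fun z => a' z + l%:R * b z N.+1))).
rewrite (eq_bigr (fun l : 'I_D.+2 => H l)); last first.
  move=> l _; rewrite /H -scalerAl -scalerAr scalerA exprD.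
  by congr (_ *: _); ring.
rewrite -(big_mkord xpredT H).
rewrite (@big_cat_nat _ _ _ (D.+2 - k)) ?leq_subr //= big_mkord.
rewrite -[X in eq_below _ X]addr0; apply: eq_belowD.
  apply: eq_below_sum => l _; apply: eq_belowZ; apply: eq_belowM => //.
  apply: eq_below_trans (IH _ _); rewrite /R.
  rewrite (@eq_series N _ (fun z => a z + k%:R * b z N.+1 + (a' z + l%:R * b z N.+1))) //.
  by move=> z _; rewrite natrD; ring.
apply: eq_below_sym; rewrite big_nat; apply: eq_below_sum0 => l lD; rewrite /H.
have := eq_belowZ (c l) (@monomial_below v D (e N.+1) (k + l) _ _ _).
by rewrite scaler0; apply; [apply: e_gt0 | lia].
Qed.

End WordSeries.

(** * The recurrence of the Gale Robinson series *)

Section GaleRobinsonSeries.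

Variables (v r t : nat).
Hypotheses (r_gt0 : (0 < r)%N) (lt_rt : (r < t)%N) (lt_rtv : (r + t < v)%N).

Definition gr_s (z : int) : rat := (npartitions2 r (v - r) z)%:R.

Definition gr_weight (m : int) (x : nat) : rat := gr_s (m - x%:Z).

Definition gr_pair (x x' : nat) : rat :=
  - gr_s (x'%:Z - x%:Z) - gr_s (x'%:Z - x%:Z - v%:Z)
  + gr_s (x'%:Z - x%:Z - t%:Z) + gr_s (x'%:Z - x%:Z - v%:Z + t%:Z).

Definition letter_monomial (x : nat) : 'X_{1..v} :=
  [multinom npartitions2 r (v - r) (x%:Z - (i.+1)%:Z) | i < v].

Lemma letter_monomial_gt0 x : (0 < x)%N -> (0 < mdeg (letter_monomial x))%N.
Proof.
(* The index congruent to x modulo r: the difference is a multiple of r. *)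
case: x => // x _; have lt_v : (x %% r < v)%N.
  by apply: leq_trans (ltn_pmod x r_gt0) _; lia.
rewrite mdegE (bigD1 (Ordinal lt_v)) //= mnmE addn_gt0; apply/orP; left.
have -> : (x.+1)%:Z - ((x %% r).+1)%:Z = (x %/ r * r)%N%:Z.
  by have := divn_eq x r; move: (x %/ r * r)%N (x %% r)%N => A B; lia.
rewrite card_gt0; apply/set0Pn.
have lt1 : (x %/ r < (x %/ r * r).+1)%N by rewrite ltnS leq_pmulr.
by exists (Ordinal lt1, ord0); rewrite inE /= mul0n addn0.
Qed.

Lemma gr_s_neg z : z < 0 -> gr_s z = 0.
Proof. by move=> z_lt0; rewrite /gr_s npartitions2_neg. Qed.

Lemma gr_s_recurrence z :
  gr_s z + gr_s (z - v%:Z) =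
  gr_s (z - r%:Z) + gr_s (z - v%:Z + r%:Z) + (z == 0)%:R.
Proof.
have v_r : (0 < v - r)%N by lia.
have := @npartitions2_recurrence r (v - r) z r_gt0 v_r.
have -> : z - r%:Z - (v - r)%N%:Z = z - v%:Z by lia.
have -> : z - (v - r)%N%:Z = z - v%:Z + r%:Z by lia.
by rewrite /gr_s -!natrD => ->.
Qed.

Variable D : nat.

(** The series whose weight belongs to F_(k+1-v), in the indexing of
    [gr_value]. *)
Definition gr_series (k : nat) : {mpoly rat[v]} :=
  series D gr_pair letter_monomial (k.+1 - v) (gr_weight (k.+1%:Z - v%:Z)).

Lemma gr_series_small k : (k < v)%N -> gr_series k = 1.
Proof. by rewrite /gr_series -subn_eq0 => /eqP ->. Qed.

Lemma gr_series_alphabet k N : (k.+1 - v <= N)%N ->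
  series D gr_pair letter_monomial N (gr_weight (k.+1%:Z - v%:Z)) = gr_series k.
Proof.
move=> le_kN; apply: series_widen => // z zN; apply: gr_s_neg; lia.
Qed.

(** On the weights, the recurrence of partition numbers reads W (n + v) + W n
    = W (n + r) + W (n + (v - r)) + delta, where delta is 1 at the letter
    n.+1 and 0 elsewhere; the interactions with the letter n.+1 turn the
    weights for r into those for t. Multiplicativity of the series translates
    both. *)
Lemma gr_series_recurrence n :
  eq_below D (gr_series (n + v) * gr_series n)
    ('X_[letter_monomial n.+1] * (gr_series (n + t) * gr_series (n + (v - t)))
     + gr_series (n + r) * gr_series (n + (v - r))).
Proof.
pose S := series D gr_pair letter_monomial.
pose W k := gr_weight (k.+1%:Z - v%:Z).
pose delta (z : nat) : rat := (z == n.+1)%:R.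
have S_add N a a' : eq_below D (S N (fun z => a z + a' z)) (S N a * S N a').
  exact/seriesD/letter_monomial_gt0.
have SE k N : (k.+1 - v <= N)%N -> S N (W k) = gr_series k.
  exact: gr_series_alphabet.
have W_rec z : (0 < z)%N -> W (n + v)%N z + W n z = W (n + r)%N z + W (n + (v - r))%N z + delta z.
  move=> z_gt0; have := gr_s_recurrence (n.+1%:Z - z%:Z).
  rewrite /W /delta /gr_weight.
  have -> : (n + v)%N.+1%:Z - v%:Z - z%:Z = n.+1%:Z - z%:Z by lia.
  have -> : n.+1%:Z - v%:Z - z%:Z = n.+1%:Z - z%:Z - v%:Z by lia.
  have -> : (n + r)%N.+1%:Z - v%:Z - z%:Z = n.+1%:Z - z%:Z - v%:Z + r%:Z by lia.
  have -> : (n + (v - r))%N.+1%:Z - v%:Z - z%:Z = n.+1%:Z - z%:Z - r%:Z by lia.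
  have -> : (z == n.+1) = (n.+1%:Z - z%:Z == 0) by lia.
  by move->; ring.
have W_pair z : (0 < z <= n)%N ->
    W (n + r)%N z + W (n + (v - r))%N z + gr_pair z n.+1 = W (n + t)%N z + W (n + (v - t))%N z.
  move=> /andP[z_gt0 le_zn]; have := W_rec z z_gt0.
  have -> : delta z = 0 by rewrite /delta (_ : (z == n.+1) = false) //; lia.
  rewrite addr0 => <-; rewrite /gr_pair /W /gr_weight.
  have -> : (n + v)%N.+1%:Z - v%:Z - z%:Z = n.+1%:Z - z%:Z by lia.
  have -> : n.+1%:Z - v%:Z - z%:Z = n.+1%:Z - z%:Z - v%:Z by lia.
  have -> : (n + t)%N.+1%:Z - v%:Z - z%:Z = n.+1%:Z - z%:Z - v%:Z + t%:Z by lia.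
  have -> : (n + (v - t))%N.+1%:Z - v%:Z - z%:Z = n.+1%:Z - z%:Z - t%:Z by lia.
  ring.
rewrite -!(SE _ n.+1); [|lia..].
apply: eq_below_trans (eq_below_sym (S_add _ _ _)) _.
have -> : S n.+1 (fun z => W (n + v)%N z + W n z) =
    S n.+1 (fun z => (W (n + r)%N z + W (n + (v - r))%N z) + delta z).
  by apply: eq_series => z /andP[z_gt0 _]; apply: W_rec.
apply: eq_below_trans (S_add _ _ _) _.
rewrite [S n.+1 delta]series_unit; last first.
- by move=> z le_zn; rewrite /delta (_ : (z == n.+1) = false) //; lia.
- by rewrite /delta eqxx.
rewrite mulrDr mulr1 addrC; apply: eq_belowD; last exact: S_add.
rewrite mulrCA; apply: eq_belowM; first exact: eq_below_refl.
have -> : S n.+1 (fun z => W (n + r)%N z + W (n + (v - r))%N z) =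
          S n (fun z => W (n + r)%N z + W (n + (v - r))%N z).
  apply: series_top0; rewrite /W /gr_weight !gr_s_neg ?addr0 //; lia.
apply: eq_below_trans (eq_below_sym (S_add _ _ _)) _.
have -> : S n (fun z => (W (n + r)%N z + W (n + (v - r))%N z) + gr_pair z n.+1) =
    S n (fun z => W (n + t)%N z + W (n + (v - t))%N z).
  by apply: eq_series => z; apply: W_pair.
by rewrite !SE; [|lia..]; rewrite -!(SE _ n); [|lia..]; apply: S_add.
Qed.

End GaleRobinsonSeries.

(** * Expansion of the series over words *)

Section Words.

Lemma prod_count_rem (B : nat) (x : nat) (w : seq nat) : x \in w -> (x < B)%N ->
  (\prod_(y < B) (count_mem (y : nat) w)`! =
   count_mem x w * \prod_(y < B) (count_mem (y : nat) (rem x w))`!)%N.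
Proof.
move=> xw ltxB; rewrite (bigD1 (Ordinal ltxB)) //=.
rewrite [in RHS](bigD1 (Ordinal ltxB)) //= mulnA; congr (_ * _)%N.
  rewrite count_rem /= eqxx xw /=.
  have : (0 < count_mem x w)%N by rewrite -has_count has_pred1.
  by case: (count_mem x w) => // c _; rewrite subn1 factS.
apply: eq_bigr => y; rewrite -val_eqE /= => neq_yx.
by rewrite count_rem /= eq_sym (negPf neq_yx) andbF subn0.
Qed.

Lemma sum_count_undup (w : seq nat) : (\sum_(x <- undup w) count_mem x w = size w)%N.
Proof.
rewrite -[RHS](perm_size (perm_count_undup w)) size_flatten sumnE /shape !big_map.
by apply: eq_bigr => x _; rewrite size_nseq.
Qed.

(** The multinomial coefficient, by the choice of the first entry of a
    permutation. *)
Lemma size_permutations_count (B : nat) (w : seq nat) : all (fun x => x < B)%N w ->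
  (size (permutations w) * \prod_(y < B) (count_mem (y : nat) w)`! = (size w)`!)%N.
Proof.
move Dn: (size w) => n; elim: n w Dn => [|n IH] w Dn ltwB.
  by rewrite (nilP (introT eqP Dn)) /= mul1n big1.
rewrite (perm_size (permutationsE _)) ?Dn // size_allpairs_dep sumnE big_map.
rewrite big_distrl /= factS -Dn -sum_count_undup big_distrl /=.
rewrite big_seq [RHS]big_seq; apply: eq_bigr => x; rewrite mem_undup => xw.
rewrite (prod_count_rem xw); last exact: (allP ltwB).
rewrite mulnCA; congr (_ * _)%N; apply: IH; first by rewrite size_rem // Dn.
by apply/allP => y /mem_rem/(allP ltwB).
Qed.

Lemma phiE (B : nat) (w : seq nat) : all (fun x => x < B)%N w ->
  phi w = (\prod_(y < B) (count_mem (y : nat) w)`!)%N%:R^-1.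
Proof.
move=> /size_permutations_count; rewrite /phi => <-; rewrite natrM invfM mulrA.
rewrite divff ?mul1r // pnatr_eq0 size_eq0.
by apply: contraTneq (perm_refl w) => e; rewrite -mem_permutations e.
Qed.

Lemma phi_block (N k : nat) (u : seq nat) : all (fun x => x < N)%N u ->
  phi (u ++ nseq k N) = phi u / k`!%:R.
Proof.
move=> ltuN; have ltuN1 : all (fun x => x < N.+1)%N u.
  by apply: sub_all ltuN => x; apply: ltnW.
rewrite !(@phiE N.+1) //; last by rewrite all_cat ltuN1 all_nseq ltnSn orbT.
rewrite -invfM -natrM; congr (_%:R^-1); rewrite !big_ord_recr /=.
have uN : N \notin u.
  by apply/negP => /(allP ltuN); rewrite ltnn.
rewrite !count_cat !count_nseq /= eqxx mul1n (count_memPn uN) add0n fact0 muln1.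
congr (_ * _)%N; apply: eq_bigr => y _; rewrite count_cat count_nseq /=.
by rewrite gtn_eqF // mul0n addn0.
Qed.

Variables (v D : nat) (b : nat -> nat -> rat) (e : nat -> 'X_{1..v}).
Hypothesis b_diag : forall N, b N N = -1.

(** The product over the positions of a word, by recursion on its first
    letter; this form lets a block of largest letters be split off at the
    end. *)
Fixpoint word_product (a : nat -> rat) (w : seq nat) : rat :=
  if w is x :: w' then (a x + \sum_(y <- w') b x y) * word_product a w' else 1.

Lemma word_productE a w :
  \prod_(0 <= i < size w)
    (a (nth 0%N w i) + \sum_(i.+1 <= j < size w) b (nth 0%N w i) (nth 0%N w j))
  = word_product a w.
Proof.
elim: w => [|x w IH]; first by rewrite big_geq.
rewrite /= big_nat_recl //= -IH; congr (_ * _).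
  by congr (_ + _); rewrite big_add1 [RHS](big_nth 0%N).
by apply: eq_bigr => i _; congr (_ + _); rewrite big_add1.
Qed.

(** As b N N = -1, the k letters N contribute a N, a N - 1, and so on, from
    the last to the first. *)
Lemma word_product_block a u k N :
  word_product a (u ++ nseq k N) =
  word_product (fun z => a z + k%:R * b z N) u * \prod_(l < k) (a N - l%:R).
Proof.
elim: u => [|x u IH] /=.
  rewrite mul1r; elim: k => [|k IHk] /=; first by rewrite big_ord0.
  rewrite IHk big_ord_recr mulrC; congr (_ * (_ + _)).
  by rewrite big_nseq iter_addr addr0 b_diag mulNrn.
rewrite IH mulrA; congr (_ * _ * _); rewrite -addrA; congr (_ + _).
by rewrite big_cat /= big_nseq iter_addr addr0 mulr_natl addrC.
Qed.

(** The nondecreasing words in the letters 1..N that occur in [series], with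
    multiplicities at most D.+1. *)
Fixpoint bounded_words (N : nat) : seq (seq nat) :=
  if N is N'.+1 then
    [seq u ++ nseq k N | u <- bounded_words N', k <- iota 0 D.+2]
  else [:: [::]].

Lemma bounded_words_le N w : w \in bounded_words N ->
  all (fun x => 0 < x <= N)%N w.
Proof.
elim: N w => [|N IH] w; first by rewrite inE => /eqP ->.
case/allpairsP => -[u k] [/IH uN _ ->] /=; rewrite all_cat all_nseq /= leqnn orbT andbT.
by apply: sub_all uN => x /andP[-> /leqW].
Qed.

Lemma bounded_words_lt N w : w \in bounded_words N -> all (fun x => x < N.+1)%N w.
Proof. by move/bounded_words_le; apply: sub_all => x /andP[]. Qed.

Lemma pairwise_block u k N : pairwise leq u -> all (fun x => x <= N)%N u ->
  pairwise leq (u ++ nseq k N).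
Proof.
move=> uP uN; rewrite pairwise_cat uP /=; apply/andP; split.
  by apply/allrelP => x y /(allP uN) xN /nseqP[-> _].
by elim: k => //= k ->; rewrite all_nseq leqnn orbT.
Qed.

Lemma bounded_words_words N : all (words N) (bounded_words N).
Proof.
apply/allP => w wN; rewrite /words bounded_words_le // andbT.
rewrite (sorted_pairwise leq_trans).
elim: N w wN => [|N IH] w; first by rewrite inE => /eqP ->.
case/allpairsP => -[u k] [uN _ ->]; apply: pairwise_block; first exact: IH.
by apply: sub_all (bounded_words_le uN) => x /andP[_ /leqW].
Qed.

Lemma filter_block u k N : all (fun x => x < N)%N u ->
  [seq x <- u ++ nseq k N | (x < N)%N] = u.
Proof.
move=> uN; rewrite filter_cat (all_filterP uN) -[RHS]cats0; congr (_ ++ _).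
by elim: k => //= k ->; rewrite ltnn.
Qed.

Lemma bounded_words_uniq N : uniq (bounded_words N).
Proof.
elim: N => [|N IH]; first by [].
apply: allpairs_uniq => //; first exact: iota_uniq.
move=> [w1 k1] [w2 k2] /allpairsP[[u k] [/bounded_words_lt uN _ [-> ->]]].
case/allpairsP => [[u' k'] [/bounded_words_lt uN' _ [-> ->]]] eq_w.
rewrite /= in uN uN' eq_w *.
have eq_u : u = u' by rewrite -(filter_block k uN) eq_w filter_block.
rewrite eq_u in eq_w *; congr pair.
by have := congr1 size eq_w; rewrite !size_cat !size_nseq => /addnI.
Qed.

Lemma bounded_words_complete N w : words N w ->
  (forall x, count_mem x w <= D.+1)%N -> w \in bounded_words N.
Proof.
rewrite /words; elim: N w => [|N IH] w /andP[w_sorted wN] count_le.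
  case: w w_sorted wN count_le => // x w _ /andP[]; lia.
pose u := [seq x <- w | (x < N.+1)%N]; pose k := count_mem N.+1 w.
have subw x : x \in u -> x \in w by rewrite mem_filter => /andP[].
(* Both are nondecreasing with the same letters. *)
have -> : w = u ++ nseq k N.+1.
  apply: (sorted_eq leq_trans anti_leq) => //.
    rewrite (sorted_pairwise leq_trans); apply: pairwise_block.
      rewrite -(sorted_pairwise leq_trans).
      exact: (sorted_filter leq_trans).
    by apply/allP => x; rewrite mem_filter => /andP[/ltnW].
  rewrite -(perm_filterC (fun x => x < N.+1)%N w) perm_cat2l.
  have /all_pred1P -> : all (pred1 N.+1) [seq x <- w | predC (fun x => x < N.+1)%N x].
    apply/allP => x; rewrite mem_filter /= -leqNgt => /andP[ltNx /(allP wN)/andP[_ leN]].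
    by rewrite eqn_leq leN.
  rewrite size_filter /k (@eq_in_count _ _ (pred1 N.+1)) // => x /(allP wN)/andP[_ leN] /=.
  by rewrite -leqNgt eqn_leq leN.
apply: allpairs_f; last by rewrite mem_iota /= add0n ltnS count_le.
apply: IH.
  rewrite (sorted_filter leq_trans) //=; apply/allP => x xu.
  have /andP[-> _] := allP wN x (subw x xu).
  by move: xu; rewrite mem_filter => /andP[].
by move=> x; apply: leq_trans (count_le x); apply: leq_count_subseq; apply: filter_subseq.
Qed.

Definition word_monomial (w : seq nat) : 'X_{1..v} := (\sum_(x <- w) e x)%MM.

Lemma word_monomial_block u k N :
  'X_[word_monomial (u ++ nseq k N)] =
    'X_[e N] ^+ k * 'X_[word_monomial u] :> {mpoly rat[v]}.
Proof.
rewrite mpolyXn mulrC -mpolyXD; congr 'X_[_]; apply/mnmP => i.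
rewrite mnmDE mulmnE /word_monomial !mnm_sumE big_cat /=; congr (_ + _)%N.
by rewrite big_nseq iter_addn_0.
Qed.

Theorem series_words N a :
  series D b e N a =
  \sum_(w <- bounded_words N) (phi w * word_product a w) *: 'X_[word_monomial w].
Proof.
elim: N a => [|N IH] a.
  rewrite big_seq1 /= mulr1 /word_monomial big_nil mpolyX0.
  by rewrite (@phiE 1%N) // big_ord1 invr1 scale1r.
rewrite big_allpairs_dep exchange_big [LHS]/=.
rewrite -(big_mkord xpredT (fun k => gbinom (a N.+1) k *: ('X_[e N.+1] ^+ k *
    series D b e N (fun z => a z + k%:R * b z N.+1)))) /index_iota subn0.
apply: eq_bigr => k _; rewrite IH mulr_sumr scaler_sumr.
rewrite big_seq [RHS]big_seq; apply: eq_bigr => u uN.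
rewrite word_monomial_block -scalerAr scalerA; congr (_ *: _).
rewrite phi_block ?bounded_words_lt // word_product_block /gbinom; ring.
Qed.

Hypothesis e_gt0 : forall N, (0 < N)%N -> (0 < mdeg (e N))%N.

Lemma size_word_monomial N w : all (fun x => 0 < x <= N)%N w ->
  (size w <= mdeg (word_monomial w))%N.
Proof.
move=> wN; rewrite /word_monomial mdeg_sum -sum1_size big_seq [leqRHS]big_seq.
by apply: leq_sum => x /(allP wN)/andP[x_gt0 _]; apply: e_gt0.
Qed.

End Words.

(** * F-polynomials *)

Lemma run_gt0 (T : finType) (q : quiver T) (x : T -> rat) path :
  positive x -> positive (run (q, x) path).2.
Proof.
elim: path q x => [|k path IH] q x x_gt0 //.
by rewrite run_cons; apply: IH; apply: relabel_gt0 => //; apply: exchange_gt0.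
Qed.

Section FPolynomials.

Variables (v r t : nat).
Hypotheses (v_gt0 : (0 < v)%N) (r_gt0 : (0 < r)%N) (lt_rt : (r < t)%N).
Hypothesis (lt_rtv : (r + t < v)%N).

Local Notation value y k := (gr_value r t v_gt0 y k).
Let generic (i : 'I_v) : rational_function v := tofrac 'X_i.

(** The constant term makes P invertible as a power series; the values at
    positive points carry the Laurent phenomenon; the last two conditions are
    the two descriptions of F to be compared. *)
Record F_polynomial (k : nat) (P : {mpoly rat[v]}) : Prop := {
  F_constant : P@_0%MM = 1;
  F_value : forall y : 'I_v -> rat, positive y -> value y k = P.@[y];
  F_rational : value generic k = tofrac P;
  F_series : forall D, eq_below D P (gr_series v r t D k) }.

Lemma value_gt0 (y : 'I_v -> rat) k : positive y -> 0 < value y k.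
Proof.
move=> y_gt0; rewrite /gr_value; case: ifP => // _.
by apply: run_gt0; case.
Qed.

Lemma value_laurent n : exists a, exists p : {mpoly rat[v]},
  forall y : 'I_v -> rat, positive y -> value y (n + v) * 'X_[a].@[y] = p.@[y].
Proof.
have framed_red : reduced (framed (gale_robinson r t : quiver 'I_v)).
  exact: (gr_seed_reduced v_gt0 r_gt0 lt_rt lt_rtv (fun=> 0 : rat) 0).
pose path := [seq inl (cyclic_sequence v_gt0 k) | k <- iota 1 n.+1] : seq ('I_v + 'I_v).
have := laurent_phenomenon path (inl (vertex v_gt0 n 0)) framed_red.
move/laurent_mpoly => [a [p pE]]; exists a, p => y y_gt0.
by rewrite -pE // gr_value_step.
Qed.

Definition exchange_monomial n : 'X_{1..v} := letter_monomial v r n.+1.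

Lemma exchange_monomialE n i :
  exchange_monomial n i = npartitions2 r (v - r) (n%:Z - i%:Z).
Proof. by rewrite mnmE; congr npartitions2; lia. Qed.

(** A Laurent polynomial G / 'X_[a] for the value at n + v comes from the
    Laurent phenomenon. Its product with the polynomial P0 at n is the
    right-hand side N of the exchange relation, so 'X_[a] divides G. The
    relation P * P0 = N then gives all properties of P from those of smaller
    indices. *)
Lemma F_polynomial_exists k : exists P, F_polynomial k P.
Proof.
elim/ltn_ind: k => k IH; have [ltkv|levk] := ltnP k v.
  exists 1; split=> [|y _||D].
  - by rewrite mcoeff1 eqxx.
  - by rewrite gr_value_small // meval1.
  - by rewrite gr_value_small // tofrac1.
  - by rewrite gr_series_small.
rewrite -(subnK levk); set n := (k - v)%N.
have IHn m : (m < v)%N -> exists P, F_polynomial (n + m) P.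
  by move=> ltmv; apply: IH; rewrite /n; lia.
have [P0 []] := IHn 0%N v_gt0; rewrite addn0 => c0 v0 f0 s0.
have [|Pt [ct vt ft st]] := IHn t; first lia.
have [|Pu [cu vu fu su]] := IHn (v - t)%N; first lia.
have [|Pr [cr vr fr sr]] := IHn r; first lia.
have [|Pw [cw vw fw sw]] := IHn (v - r)%N; first lia.
(* P0, Pt, Pu, Pr, Pw stand at n, n + t, n + (v - t), n + r, n + (v - r). *)
pose X : {mpoly rat[v]} := 'X_[exchange_monomial n].
pose N := X * (Pt * Pu) + Pr * Pw.
have valueE y : positive y -> value y (n + v) * P0.@[y] = N.@[y].
  move=> y_gt0; have v0_neq0 : P0.@[y] != 0 by rewrite -v0 // lt0r_neq0 ?value_gt0.
  rewrite gr_value_recurrence // v0 // divfK //.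
  rewrite vt // vu // vr // vw // mevalD !mevalM mevalX.
  by congr (_ * _ + _); apply: eq_bigr => i _; rewrite exchange_monomialE.
have [a [G GE]] := value_laurent n.
have X_gt0 y : positive y -> 'X_[a].@[y] != 0.
  by move=> y_gt0; rewrite mevalX lt0r_neq0 // monomial_gt0.
have P0_neq0 : P0@_0%MM != 0 by rewrite c0 oner_eq0.
have [P GP] : exists P, G = 'X_[a] * P.
  apply: (monomial_quotient (p := N) P0_neq0).
  apply/eqP; rewrite -subr_eq0; apply/eqP/mpoly_zero_positive => y y_gt0.
  by rewrite mevalB !mevalM -GE // -valueE //; ring.
have PE y : positive y -> value y (n + v) = P.@[y].
  move=> y_gt0; apply: (mulIf (X_gt0 y y_gt0)).
  by rewrite GE // GP mevalM mulrC.
have PP0 : P * P0 = N.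
  apply/eqP; rewrite -subr_eq0; apply/eqP/mpoly_zero_positive => y y_gt0.
  by rewrite mevalB mevalM -PE // valueE // subrr.
exists P; split=> // [||D].
- have := congr1 (mcoeff 0%MM) PP0; rewrite rmorphM /= c0 mulr1 => ->.
  rewrite rmorphD !rmorphM /= cr cw mcoeffX mulr1.
  have := letter_monomial_gt0 r_gt0 lt_rt lt_rtv (ltn0Sn n).
  by rewrite lt0n mdeg_eq0 => /negPf ->; rewrite mul0r add0r.
- have P0_neq : tofrac P0 != 0.
    by rewrite tofrac_eq0; apply: contra_neq P0_neq0 => ->; rewrite mcoeff0.
  rewrite gr_value_recurrence // f0 ft fu fr fw.
  apply: (mulIf P0_neq); rewrite divfK // -[RHS]tofracM PP0.
  rewrite /N tofracD !tofracM; congr (_ * _ + _).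
  rewrite /X mpolyXE_id rmorph_prod; apply: eq_bigr => i _.
  by rewrite rmorphXn exchange_monomialE.
apply: (eq_below_cancel P0_neq0); rewrite PP0.
have N_series := eq_belowD
  (eq_belowM (@eq_below_refl v D X) (eq_belowM (st D) (su D)))
  (eq_belowM (sr D) (sw D)).
apply: (eq_below_trans N_series).
apply: (eq_below_trans (eq_below_sym (gr_series_recurrence r_gt0 lt_rt lt_rtv (D := D) n))).
by apply: eq_belowM; [apply: eq_below_refl | apply: eq_below_sym].
Qed.

End FPolynomials.

Lemma seed_after_run v (q : quiver 'I_v) mu n :
  seed_after q mu n =
  let S := run (framed q, initial_label (fun i => tofrac 'X_i : rational_function v))
    [seq inl (mu k) | k <- iota 1 n] in
  {| seed_quiver := S.1; seed_label := S.2 |}.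
Proof.
elim: n => [|n IH] //; have := iotaD 1 n 1; rewrite addn1 => iotaS.
by rewrite iotaS map_cat /run foldl_cat add1n /= IH.
Qed.

Lemma word_coefE v r t n w :
  word_coef v r t n w =
  phi w * word_product (gr_pair v r t) (gr_weight v r n%:Z) w.
Proof. by rewrite -word_productE. Qed.

Lemma word_exponentE v r w :
  word_exponent v r w = word_monomial (letter_monomial v r) w.
Proof.
apply/mnmP => i; rewrite mnmE mnm_sumE.
by apply: eq_bigr => x _; rewrite mnmE.
Qed.

Theorem theorem4p9 (v r t n : nat)
    (v_gt0 : (0 < v)%N) (r_gt0 : (0 < r)%N) (lt_rt : (r < t)%N)
    (lt_rtv : (r + t < v)%N) (n_gt0 : (0 < n)%N) :
  exists F : {mpoly rat[v]},
    F_label (gale_robinson r t) (cyclic_sequence v_gt0) n = tofrac F /\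
    is_coefficientwise_sum (words n) (@word_term v r t n) F.
Proof.
case: n n_gt0 => // n _.
have [F [_ _ F_frac F_ser]] := F_polynomial_exists v_gt0 r_gt0 lt_rt lt_rtv (n + v).
exists F; split.
  rewrite -F_frac gr_value_step /F_label seed_after_run.
  by rewrite cyclic_sequence_vertex.
move=> m; pose D := (mdeg m).+1; pose e := letter_monomial v r.
exists (bounded_words D n.+1); split.
- exact: bounded_words_uniq.
- exact: bounded_words_words.
- move=> w w_word; rewrite /word_term mcoeffZ mcoeffX word_exponentE.
  case: (word_monomial e w =P m) => [eq_m _|_]; last by rewrite mulr0 eqxx.
  apply: bounded_words_complete => // x; apply: leq_trans (count_size _ _) _.
  have /andP[_ w_le] := w_word.
  have e_gt0 := letter_monomial_gt0 r_gt0 lt_rt lt_rtv.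
  apply: leq_trans (size_word_monomial e_gt0 w_le) _.
  by rewrite eq_m /D; lia.
rewrite (F_ser D m (ltnSn _)) /gr_series -addSn addnK.
have -> : ((n.+1 + v)%N%:Z - v%:Z = n.+1%:Z)%R by lia.
rewrite series_words; last first.
  move=> N; rewrite /gr_pair subrr /gr_s npartitions2_0; [|lia..].
  by rewrite !npartitions2_neg; [|lia..]; rewrite subr0 !addr0.
rewrite raddf_sum /=; apply: eq_bigr => w _.
by rewrite /word_term word_coefE word_exponentE.
Qed.
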